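(* Let $0<p<\infty$ and suppose that the norm of the operator $\mathcal{B}: f \mapsto f - f(0)$ on $H^p$ is equal to $K$. Let $\mu$ be a radial weight on $\mathbb{D}$ with $\mu(\mathbb{D}) < \infty$. Then the norm of $\mathcal{B}$ on the Bergman space $A^p(\mu)$ is at most $K$.
   Context: $\mathbb{D}$ is the open unit disc. $H^p$ is the space of analytic functions $f$ on $\mathbb{D}$ with $\|f\|_{H^p} = \sup_{0\le r<1} \left(\frac{1}{2\pi}\int_0^{2\pi} |f(re^{i\theta})|^p\,d\theta\right)^{1/p} < \infty$. A radial weight $\mu$ is a nonnegative measurable function on $\mathbb{D}$ depending only on $|z|$; $\mu(\mathbb{D}) = \int_{\mathbb{D}} \mu\,dA$, where $dA$ is normalized area measure on $\mathbb{D}$. $A^p(\mu)$ is the space of analytic functions $f$ on $\mathbb{D}$ with $\|f\|_{A^p(\mu)} = \left(\int_{\mathbb{D}} |f|^p\,\mu\,dA\right)^{1/p} < \infty$. The norm of an operator $T$ on one of these spaces is the least constant $C \geq 0$ such that $\|Tf\| \le C\|f\|$ for all $f$ in the space (also when $p<1$). *)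

(* Defs.v *)
From HB Require Import structures.
From mathcomp Require Import all_boot all_order all_algebra.
From mathcomp Require Import all_classical all_reals all_analysis.
From mathcomp Require Import complex.

Set Implicit Arguments.
Unset Strict Implicit.
Unset Printing Implicit Defensive.

Import Order.TTheory GRing.Theory Num.Theory.
Import numFieldNormedType.Exports.

Local Open Scope classical_set_scope.
Local Open Scope ring_scope.
Local Open Scope complex_scope.

Notation cmod := Normc.normc.

Definition disc (R : realType) : set R[i] := [set z | cmod z < 1].

(* Functions on the disc are represented by total functions; every notion below
   depends only on the values on the disc. Analytic means locally the sum of a
   convergent power series; [R[i]^o] only serves to select the usual topology
   of the complex plane. *)
Definition analytic_on_disc (R : realType) (f : R[i] -> R[i]) : Prop :=
  forall z0 : R[i], disc z0 ->
  exists (rho : R) (a : nat -> R[i]), 0 < rho /\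
    forall z : R[i], cmod (z - z0) < rho ->
      (series (fun k => a k * (z - z0) ^+ k : R[i]^o)) @ \oo --> (f z : R[i]^o).

Definition circle_point (R : realType) (r theta : R) : R[i] :=
  (r * cos theta) +i* (r * sin theta).

Definition circle_mean (R : realType) (p r : R) (f : R[i] -> R[i]) : \bar R :=
  (((2 * pi)^-1)%R%:E *
   \int[@lebesgue_measure R]_(theta in `[0%R, (2 * pi)%R]%classic)
     (cmod (f (circle_point r theta)) `^ p)%:E)%E.

Definition Hardy_norm (R : realType) (p : R) (f : R[i] -> R[i]) : \bar R :=
  ereal_sup [set (circle_mean p r f `^ p^-1)%E | r in [set r : R | 0 <= r < 1]].

Definition Hardy (R : realType) (p : R) : set (R[i] -> R[i]) :=
  [set f | analytic_on_disc f /\ (Hardy_norm p f < +oo)%E].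

(* Lebesgue measure on the plane is the Caratheodory completion of the product
   of the two one-dimensional Borel-Lebesgue measures; [plane R] is [R * R] with
   the sigma-algebra of all Lebesgue measurable sets. *)
Definition borel_area (R : realType) :
    {measure set (measurableTypeR R * measurableTypeR R) -> \bar R} :=
  (@lebesgue_measure R \x @lebesgue_measure R)%E.

Definition plane (R : realType) := caratheodory_type ((@borel_area R)^*)%mu.

Definition area (R : realType) : {measure set (plane R) -> \bar R} :=
  @completed_measure_extension _ _ _ (@borel_area R).

Definition to_complex (R : realType) (w : plane R) : R[i] := w.1 +i* w.2.

Definition plane_disc (R : realType) : set (plane R) :=
  @to_complex R @^-1` @disc R.

(* Integral over the disc against normalized area measure. *)
Definition disc_integral (R : realType) (g : R[i] -> R) : \bar R :=
  ((pi^-1)%R%:E * \int[@area R]_(w in @plane_disc R) (g (to_complex w))%:E)%E.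

Definition radial_weight (R : realType) (mu : R[i] -> R) : Prop :=
  [/\ forall z, disc z -> 0 <= mu z,
      measurable_fun (@plane_disc R) (mu \o @to_complex R) &
      forall z w, disc z -> disc w -> cmod z = cmod w -> mu z = mu w].

Definition Bergman_norm (R : realType) (p : R) (mu : R[i] -> R)
    (f : R[i] -> R[i]) : \bar R :=
  (disc_integral (fun z => (cmod (f z) `^ p * mu z)%R) `^ p^-1)%E.

Definition Bergman (R : realType) (p : R) (mu : R[i] -> R) :
    set (R[i] -> R[i]) :=
  [set f | analytic_on_disc f /\ (Bergman_norm p mu f < +oo)%E].

Definition op_bound (R : realType) (S : set (R[i] -> R[i]))
    (N : (R[i] -> R[i]) -> \bar R) (T : (R[i] -> R[i]) -> R[i] -> R[i])
    (C : R) : Prop :=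
  0 <= C /\ forall f, S f -> (N (T f) <= C%:E * N f)%E.

(* [K] is the least constant bounding [T], for the quasi-norm [N], on [S]. *)
Definition is_op_norm (R : realType) (S : set (R[i] -> R[i]))
    (N : (R[i] -> R[i]) -> \bar R) (T : (R[i] -> R[i]) -> R[i] -> R[i])
    (K : R) : Prop :=
  op_bound S N T K /\ forall C, op_bound S N T C -> K <= C.

Definition sub_at0 (R : realType) (f : R[i] -> R[i]) : R[i] -> R[i] :=
  fun z => f z - f 0.

(* Main.v *)
(** Rotation invariance of area and Tonelli turn the weighted area integral of
    [|f|^p] over the disc into an integral against [mu dA (z)] of the circular
    means of [|f|^p] over [|w| = |z|], so it suffices to compare the circular
    means of [|f - f 0|^p] and [|f|^p] on each circle.  That comparison is the
    Hardy space bound applied to [w |-> f (z w)], with Fatou's lemma on the left;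
    on the right one needs that circular means of [|f|^p] increase with the
    radius.  For this, averages of [|f|^p] over the rotations by the [N]-th roots
    of unity satisfy a second-order four-point sub-mean value inequality, hence
    the maximum principle, and they converge to the circular means uniformly on
    circles as [N] grows. *)
Require Import Defs.
From HB Require Import structures.
From mathcomp Require Import all_boot all_order all_algebra.
From mathcomp Require Import all_classical all_reals all_analysis.
From mathcomp Require Import complex.
From mathcomp Require Import ring lra.

Set Implicit Arguments.
Unset Strict Implicit.
Unset Printing Implicit Defensive.

Import Order.TTheory GRing.Theory Num.Theory.
Import numFieldNormedType.Exports.
Import measurable_realfun.
Local Open Scope classical_set_scope.
Local Open Scope ring_scope.
Local Open Scope complex_scope.

(** * Rotation invariance of the area *)

(** The sub-mean inequality is only local and second-order: its [delta] depends on the point and on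
    the function. Finitely many such inequalities can be added, a whole circle of them cannot, and
    this is why finite averages stand in for circular means. The maximum principle is applied with
    the number of roots of unity fixed, so no control of [delta] as that number grows has to be
    provided.

    A function of the Bergman space may lie outside the Hardy space. Its dilations [w |-> f (z * w)]
    with [cmod z < 1] always lie in it, because their means are bounded by the finite mean over the
    circle through [z]; this is where monotonicity in the radius enters. As the Hardy norm is a
    supremum over radii below 1, it controls [f - f 0] only on circles strictly inside that one, and
    the limit of radii tending to 1 remains to be taken.

    The weight is merely Lebesgue measurable, so rotation invariance has to hold for the completed
    area. It is obtained for the Borel product measure, then for the outer measure of arbitrary
    sets. *)

Lemma caratheodory_measurable_preimage (R : realType) (T : Type)
    (mu : set T -> \bar R) (f g : T -> T) (A : set T) :
  f \o g = id -> (forall X, mu (g @^-1` X) = mu X) ->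
  caratheodory_measurable mu A -> caratheodory_measurable mu (f @^-1` A).
Proof.
move=> fg muE mA X; have fgK B : g @^-1` (f @^-1` B) = B.
  by rewrite -(comp_preimage B g f) fg.
rewrite -(muE X) mA.
rewrite -(muE (X `&` _)) -(muE (X `&` ~` _)) !preimage_setI preimage_setC.
by rewrite !fgK.
Qed.

Section area_rotation.
Context {R : realType}.
Implicit Types t c s : R.
Local Notation mR := (measurableTypeR R).
Local Notation leb := (@lebesgue_measure R).

Lemma measurable_translation t :
  measurable_fun [set: mR] ((fun x : R => x + t) : mR -> mR).
Proof. exact: measurable_funD. Qed.

Lemma preimage_translation_itv t (b1 b2 : bool) (x y : R) :
  (fun u : R => u + t) @^-1` [set` Interval (BSide b1 x) (BSide b2 y)] =
  [set` Interval (BSide b1 (x - t)) (BSide b2 (y - t))].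
Proof.
by apply/seteqP; split => u /=; rewrite !in_itv /=; case: b1; case: b2 => /=;
  rewrite ?lerBlDr ?ltrBlDr ?lerBrDr ?ltrBrDr.
Qed.

Lemma lebesgue_measure_translation t (B : set mR) : measurable B ->
  pushforward leb ((fun x : R => x + t) : mR -> mR) B = leb B.
Proof.
move=> mB; apply/esym/lebesgue_measure_unique => //=.
  exact: measurable_translation.
move=> mf _ [[a b]] _ <-.
rewrite /pushforward preimage_translation_itv !lebesgue_measure_itv /=.
by rewrite !lte_fin ltrD2r; case: ifP => // _; rewrite -!EFinD; congr EFin; ring.
Qed.

Definition hshear t (w : mR * mR) : mR * mR := (w.1 + t * w.2, w.2).
Definition vshear t (w : mR * mR) : mR * mR := (w.1, w.2 + t * w.1).
Definition plane_rot c s (w : mR * mR) : mR * mR :=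
  (c * w.1 - s * w.2, s * w.1 + c * w.2).

Lemma measurable_hshear t : measurable_fun setT (hshear t).
Proof.
apply: measurable_fun_pair => //=; apply: measurable_funD => //.
exact: measurable_funM.
Qed.

Lemma measurable_vshear t : measurable_fun setT (vshear t).
Proof.
apply: measurable_fun_pair => //=; apply: measurable_funD => //.
exact: measurable_funM.
Qed.

Lemma measurable_rot c s : measurable_fun setT (plane_rot c s).
Proof.
apply: measurable_fun_pair => //=.
  by apply: measurable_funB; apply: measurable_funM.
by apply: measurable_funD; apply: measurable_funM.
Qed.

(** For the rotation by an angle [x], the number [t] is minus the tangent of [x / 2], hence the
    exclusion of the half-turn. Shears are easier than rotations for a product measure, since they
    act on the lines of one direction by translations. *)
Lemma rot_shears c s : c ^+ 2 + s ^+ 2 = 1 -> c != -1 ->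
  let t := - (s / (1 + c)) in plane_rot c s = hshear t \o vshear s \o hshear t.
Proof.
move=> cs c1 t; have c10 : 1 + c != 0.
  by apply: contra c1 => /eqP/(canRL (addKr _)); rewrite addr0 => ->.
have st : s * t = c - 1.
  have s2 : s ^+ 2 = (1 - c) * (1 + c).
    by rewrite -[s ^+ 2](addKr (c ^+ 2)) cs; ring.
  have -> : s * t = - (s ^+ 2 / (1 + c)) by rewrite /t; ring.
  by rewrite s2 mulfK // opprB.
have tc : t * (1 + c) = - s by rewrite /t mulNr divfK.
apply/funext => -[x y]; rewrite /plane_rot /hshear /vshear /=; congr pair.
  have -> : c * x - s * y = x + (c - 1) * x + t * (1 + c) * y by rewrite tc; ring.
  by rewrite (_ : c = 1 + s * t); [ring|rewrite st; ring].
by rewrite (_ : c = 1 + s * t); [ring|rewrite st; ring].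
Qed.

Lemma borel_area_vshear t (A : set (mR * mR)) : measurable A ->
  borel_area R (vshear t @^-1` A) = borel_area R A.
Proof.
move=> mA; apply: eq_integral => x _ /=.
rewrite -[RHS](lebesgue_measure_translation (t * x)); last exact: measurable_xsection.
rewrite /pushforward; congr (leb _); apply/seteqP; split => y /=;
  by rewrite !/xsection /= !inE.
Qed.

(** [borel_area] integrates the lengths of vertical sections, which vertical shears translate.
    Horizontal shears translate horizontal sections, so they call for the product taken in the other
    order. *)
Lemma borel_areaE (A : set (mR * mR)) : measurable A ->
  borel_area R A = (leb \x^ leb)%E A.
Proof.
move=> mA; apply: (product_measure_unique (m' := (leb \x^ leb)%E)) => // B C mB mC.
exact: product_measure2E.
Qed.

Lemma borel_area_hshear t (A : set (mR * mR)) : measurable A ->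
  borel_area R (hshear t @^-1` A) = borel_area R A.
Proof.
move=> mA; rewrite !borel_areaE //; last first.
  by rewrite -[X in measurable X]setTI; exact: measurable_hshear.
apply: eq_integral => y _ /=.
rewrite -[RHS](lebesgue_measure_translation (t * y)); last exact: measurable_ysection.
rewrite /pushforward; congr (leb _); apply/seteqP; split => x /=;
  by rewrite !/ysection /= !inE.
Qed.

Lemma rotM c s c' s' :
  plane_rot c s \o plane_rot c' s' = plane_rot (c * c' - s * s') (s * c' + c * s').
Proof. by apply/funext => -[x y]; rewrite /plane_rot /=; congr pair; ring. Qed.

Let borel_area_rot_shear c s (A : set (mR * mR)) : c ^+ 2 + s ^+ 2 = 1 ->
  c != -1 -> measurable A -> borel_area R (plane_rot c s @^-1` A) = borel_area R A.
Proof.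
move=> cs c1 mA; rewrite (rot_shears cs c1) !comp_preimage.
have mpre (f : mR * mR -> mR * mR) B : measurable_fun setT f -> measurable B ->
    measurable (f @^-1` B) by move=> mf mB; rewrite -[X in measurable X]setTI; exact: mf.
rewrite borel_area_hshear; last first.
  exact: (mpre _ _ (measurable_vshear _) (mpre _ _ (measurable_hshear _) mA)).
rewrite borel_area_vshear ?borel_area_hshear//.
exact: (mpre _ _ (measurable_hshear _) mA).
Qed.

Lemma borel_area_rot c s (A : set (mR * mR)) : c ^+ 2 + s ^+ 2 = 1 ->
  measurable A -> borel_area R (plane_rot c s @^-1` A) = borel_area R A.
Proof.
move=> cs mA; have [c1|] := eqVneq c (-1); last by move=> c1; exact: borel_area_rot_shear.
have s0 : s = 0.
  by apply/eqP; rewrite -sqrf_eq0 -[s ^+ 2](addKr (c ^+ 2)) cs c1; apply/eqP; ring.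
(* The half-turn is out of reach of the shears, but it is the square of the quarter-turn. *)
have -> : plane_rot c s = plane_rot 0 1 \o plane_rot 0 1.
  by rewrite rotM c1 s0; congr plane_rot; ring.
have n01 : (0 : R) != -1 by rewrite eq_sym oppr_eq0 oner_eq0.
have e01 : (0 : R) ^+ 2 + 1 ^+ 2 = 1 by ring.
rewrite comp_preimage !borel_area_rot_shear //.
by rewrite -[X in measurable X]setTI; exact: measurable_rot.
Qed.

Lemma rotK c s : c ^+ 2 + s ^+ 2 = 1 -> plane_rot c s \o plane_rot c (- s) = id.
Proof.
move=> cs; rewrite rotM; apply/funext => -[x y]; rewrite /plane_rot /=.
have -> : c * c - s * - s = 1 by rewrite -cs; ring.
by congr pair; ring.
Qed.

Local Notation outer := ((@borel_area R)^*)%mu.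

(** A measurable cover of [A] pulls back to a cover of the preimage with the same total area, which
    gives one inequality; the inverse rotation gives the other. *)
Lemma outer_area_rot c s (A : set (mR * mR)) : c ^+ 2 + s ^+ 2 = 1 ->
  outer (plane_rot c s @^-1` A) = outer A.
Proof.
have sub c' s' (B : set (mR * mR)) : c' ^+ 2 + s' ^+ 2 = 1 ->
    (outer (plane_rot c' s' @^-1` B) <= outer B)%E.
  move=> cs; apply: le_ereal_inf_tmp => _ [F [mF BF] <-].
  apply: ereal_inf_lbound; exists (fun n => plane_rot c' s' @^-1` F n).
    split; first by move=> i; rewrite -[X in measurable X]setTI; exact: measurable_rot.
    by rewrite -preimage_bigcup; exact: preimage_subset.
  by apply: eq_eseriesr => i _; exact: borel_area_rot.
move=> cs; apply/eqP; rewrite eq_le sub //=.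
have e : c ^+ 2 + (- s) ^+ 2 = 1 by rewrite sqrrN.
have {1}-> : A = plane_rot c (- s) @^-1` (plane_rot c s @^-1` A).
  by rewrite -comp_preimage rotK // preimage_id.
exact: sub.
Qed.

Lemma plane_measurable_rot c s : c ^+ 2 + s ^+ 2 = 1 ->
  measurable_fun setT (plane_rot c s : plane R -> plane R).
Proof.
move=> cs _ A mA; rewrite setTI.
have {}mA : caratheodory_measurable outer A := mA.
suff : caratheodory_measurable outer (plane_rot c s @^-1` A) by [].
apply: caratheodory_measurable_preimage mA; first exact: rotK cs.
by move=> X; apply: outer_area_rot; rewrite sqrrN.
Qed.

Lemma area_rot c s (A : set (plane R)) : c ^+ 2 + s ^+ 2 = 1 ->
  area R (plane_rot c s @^-1` A) = area R A.
Proof. exact: outer_area_rot. Qed.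

Lemma integral_area_rot c s (f : plane R -> \bar R) : c ^+ 2 + s ^+ 2 = 1 ->
  measurable_fun setT f -> (forall w, 0 <= f w)%E ->
  (\int[area R]_w f (plane_rot c s w) = \int[area R]_w f w)%E.
Proof.
move=> cs mf f0; have mr := plane_measurable_rot cs.
have := ge0_integral_pushforward mr (area R) measurableT mf (fun x _ => f0 x).
rewrite preimage_setT => <-; apply: eq_measure_integral => //= A mA _.
exact: area_rot.
Qed.
End area_rotation.

(** * Averaging over rotations by Tonelli's theorem *)

Lemma integral_average (R : realType) d (T : measurableType d)
    (nu : {sigma_finite_measure set T -> \bar R}) (D : set (measurableTypeR R))
    (S : R -> T -> T) (h m : T -> R) :
  measurable D -> measurable_fun setT h -> (forall w, 0 <= h w) ->
  measurable_fun setT m -> (forall w, 0 <= m w) ->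
  measurable_fun setT (fun tw : measurableTypeR R * T => h (S tw.1 tw.2)) ->
  (forall t w, m (S t w) = m w) ->
  (forall t (f : T -> \bar R), measurable_fun setT f -> (forall w, 0 <= f w)%E ->
    (\int[nu]_w f (S t w) = \int[nu]_w f w)%E) ->
  let A w := ((m w)%:E * \int[lebesgue_measure]_(t in D) (h (S t w))%:E)%E in
  measurable_fun setT A /\
  (lebesgue_measure D * \int[nu]_w (h w * m w)%:E = \int[nu]_w A w)%E.
Proof.
move=> mD mh h0 mm m0 mhS mS invS A.
pose g (tw : measurableTypeR R * T) : \bar R :=
  (\1_D tw.1 * (h (S tw.1 tw.2) * m tw.2))%:E.
have mg : measurable_fun setT g.
  apply/measurable_EFinP; apply: measurable_funM => //.
    by apply: (measurableT_comp (measurable_indic mD)).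
  by apply: measurable_funM => //; exact: (measurableT_comp mm).
have g0 tw : (0 <= g tw)%E by rewrite lee_fin !mulr_ge0.
have AE w : A w = (\int[lebesgue_measure]_t g (t, w))%E.
  rewrite /A [in LHS]integral_mkcond /= -ge0_integralZl_EFin //; first last.
  - apply/(measurable_restrictT _ mD)/measurable_EFinP.
    by apply: measurable_funTS; exact: (measurable_fun_pair1 w mhS).
  - by move=> t _; apply: erestrict_ge0 => u _; rewrite lee_fin.
  apply: eq_integral => t _; rewrite /g patchE indicE /=.
  by case: (t \in D); rewrite ?mule0 ?mul0r // mul1r mulrC.
split.
  rewrite (_ : A = fubini_G lebesgue_measure g); last exact/funext.
  exact: measurable_fun_fubini_tonelli_G.
under [RHS]eq_integral do rewrite AE.
(* Integrating [g] over [t] first yields [A]. Over [w] first, [m w] may be replaced by [m (S t w)],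
   so that invariance of [nu] removes [S t] and leaves a constant on [D]. *)
have := fubini_tonelli (m1 := lebesgue_measure) (m2 := nu) g mg g0.
rewrite (eq_integral (fun t : measurableTypeR R =>
  (\1_D t)%:E * \int[nu]_w (h w * m w)%:E)%E); last first.
  move=> t _; rewrite /g /= -ge0_integralZl_EFin //; first last.
  - exact/measurable_EFinP/measurable_funM.
  - by move=> w _; rewrite lee_fin mulr_ge0.
  rewrite -(invS t (fun w => (\1_D t)%:E * (h w * m w)%:E)%E) /=.
  - by apply: eq_integral => w _; rewrite mS.
  - by apply/measurable_EFinP; do 2 apply: measurable_funM => //.
  - by move=> w; rewrite lee_fin !mulr_ge0.
rewrite ge0_integralZr //; first last.
- by apply: integral_ge0 => w _; rewrite lee_fin mulr_ge0.
- by apply/measurable_EFinP; exact: measurable_indic.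
by rewrite integral_indic // setIT.
Qed.

(** The averaged inequality is asked only where [m] is nonzero; with a weight cut off outside the
    disc, this confines it to orbits inside the disc. *)
Lemma integral_average_le (R : realType) d (T : measurableType d)
    (nu : {sigma_finite_measure set T -> \bar R}) (D : set (measurableTypeR R))
    (S : R -> T -> T) (h1 h2 m : T -> R) (l k : R) :
  measurable D -> lebesgue_measure D = l%:E -> 0 < l -> 0 <= k ->
  measurable_fun setT h1 -> (forall w, 0 <= h1 w) ->
  measurable_fun setT h2 -> (forall w, 0 <= h2 w) ->
  measurable_fun setT m -> (forall w, 0 <= m w) ->
  measurable_fun setT (fun tw : measurableTypeR R * T => h1 (S tw.1 tw.2)) ->
  measurable_fun setT (fun tw : measurableTypeR R * T => h2 (S tw.1 tw.2)) ->
  (forall t w, m (S t w) = m w) ->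
  (forall t (f : T -> \bar R), measurable_fun setT f -> (forall w, 0 <= f w)%E ->
    (\int[nu]_w f (S t w) = \int[nu]_w f w)%E) ->
  (forall w, m w != 0 ->
    (\int[lebesgue_measure]_(t in D) (h1 (S t w))%:E <=
     k%:E * \int[lebesgue_measure]_(t in D) (h2 (S t w))%:E)%E) ->
  (\int[nu]_w (h1 w * m w)%:E <= k%:E * \int[nu]_w (h2 w * m w)%:E)%E.
Proof.
move=> mD Dl l0 k0 mh1 h10 mh2 h20 mm m0 mhS1 mhS2 mS invS h12.
have [mA1 A1] := integral_average mD mh1 h10 mm m0 mhS1 mS invS.
have [mA2 A2] := integral_average mD mh2 h20 mm m0 mhS2 mS invS.
have A0 (h : T -> R) w : (forall w, 0 <= h w) -> (0 <= (m w)%:E *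
    \int[lebesgue_measure]_(t in D) (h (S t w))%:E)%E.
  move=> h0; apply: mule_ge0; first by rewrite lee_fin.
  by apply: integral_ge0 => t _; rewrite lee_fin.
rewrite Dl in A1 A2; rewrite -(@lee_pmul2l _ l%:E) ?lte_fin // muleCA A1 A2.
rewrite -ge0_integralZl_EFin //; last by move=> w _; exact: A0.
apply: ge0_le_integral; first exact: measurableT.
- by move=> w _; exact: A0.
- exact: mA1.
- by apply: emeasurable_funM; [exact: measurable_cst|exact: mA2].
move=> w _; have [mw0|mw0] := eqVneq (m w) 0.
  by rewrite mw0 !mul0e mule0.
by rewrite muleCA; apply: lee_wpmul2l; [rewrite lee_fin|exact: h12].
Qed.

Section radial_average.
Context {R : realType}.
Local Notation mR := (measurableTypeR R).
Local Notation leb := (@lebesgue_measure R).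

Let sigma_finite_area : sigma_finite [set: plane R] (area R).
Proof.
apply: completed_measure_extension_sigma_finite.
have /sigma_finiteP[F [TF ndF Foo]] := sigma_finiteT leb.
exists (fun n => F n `*` F n).
  apply/seteqP; split => // -[x y] _.
  have [n _ Fnx] : (\bigcup_i F i) x by rewrite -TF.
  have [k _ Fky] : (\bigcup_i F i) y by rewrite -TF.
  exists (maxn n k) => //; split => /=.
    by move: x Fnx; exact/subsetPset/ndF/leq_maxl.
  by move: y Fky; exact/subsetPset/ndF/leq_maxr.
move=> k; have [? ?] := Foo k; split; first exact: measurableX.
by rewrite /borel_area /= product_measure1E // lte_mul_pinfty // ge0_fin_numE.
Qed.

(* [area] under a name to which sigma-finiteness can be attached canonically. *)
Definition sigma_finite_area_measure : set (plane R) -> \bar R :=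
  @completed_measure_extension _ _ _ (borel_area R).
HB.instance Definition _ := Measure.on sigma_finite_area_measure.
HB.instance Definition _ := Measure_isSigmaFinite.Build _ _ _
  sigma_finite_area_measure sigma_finite_area.

Lemma measurable_plane_id :
  measurable_fun setT (fun w : plane R => w : mR * mR).
Proof.
by move=> _ A mA; rewrite setTI; exact: caratheodory_measurable_mu_ext.
Qed.

Lemma measurable_plane_borel (h : mR * mR -> R) : measurable_fun setT h ->
  measurable_fun setT (fun w : plane R => h w).
Proof. by move=> mh; apply: (measurableT_comp mh measurable_plane_id). Qed.

Lemma measurable_rot_angle :
  measurable_fun setT
    (fun tw : mR * plane R => plane_rot (cos tw.1) (sin tw.1) tw.2 : mR * mR).
Proof.
have mc : measurable_fun setT (fun tw : mR * plane R => cos tw.1 : mR).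
  apply: (@measurableT_comp _ _ _ _ _ _ (cos : mR -> mR)) => //.
  by apply: continuous_measurable_fun; exact: continuous_cos.
have ms : measurable_fun setT (fun tw : mR * plane R => sin tw.1 : mR).
  apply: (@measurableT_comp _ _ _ _ _ _ (sin : mR -> mR)) => //.
  by apply: continuous_measurable_fun; exact: continuous_sin.
have m2 : measurable_fun setT (fun tw : mR * plane R => tw.2 : mR * mR).
  exact: (measurableT_comp measurable_plane_id measurable_snd).
have m21 : measurable_fun setT (fun tw : mR * plane R => tw.2.1 : mR).
  exact: (measurableT_comp measurable_fst m2).
have m22 : measurable_fun setT (fun tw : mR * plane R => tw.2.2 : mR).
  exact: (measurableT_comp measurable_snd m2).
apply: measurable_fun_pair => /=.
  by apply: measurable_funB; apply: measurable_funM.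
by apply: measurable_funD; apply: measurable_funM.
Qed.

(** [h1] and [h2] are Borel because they get composed with the joint map of angle and point, whose
    target carries the Borel sets. Being rotation invariant, [m] is only evaluated at the point
    itself and may be just Lebesgue measurable. *)
Lemma integral_radial_le (D : set mR) (d k : R) (h1 h2 : mR * mR -> R)
    (m : plane R -> R) :
  measurable D -> leb D = d%:E -> 0 < d -> 0 <= k ->
  measurable_fun setT h1 -> (forall w, 0 <= h1 w) ->
  measurable_fun setT h2 -> (forall w, 0 <= h2 w) ->
  measurable_fun setT m -> (forall w, 0 <= m w) ->
  (forall c s w, c ^+ 2 + s ^+ 2 = 1 -> m (plane_rot c s w) = m w) ->
  (forall w, m w != 0 ->
    (\int[leb]_(t in D) (h1 (plane_rot (cos t) (sin t) w))%:E <=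
     k%:E * \int[leb]_(t in D) (h2 (plane_rot (cos t) (sin t) w))%:E)%E) ->
  (\int[area R]_w (h1 w * m w)%:E <= k%:E * \int[area R]_w (h2 w * m w)%:E)%E.
Proof.
move=> mD De d0 k0 mh1 h10 mh2 h20 mm m0 mrot h12.
apply: (@integral_average_le R _ (plane R) sigma_finite_area_measure D
  (fun t => plane_rot (cos t) (sin t)) h1 h2 m d k mD De d0 k0
  (measurable_plane_borel mh1) h10 (measurable_plane_borel mh2) h20 mm m0
  (measurableT_comp mh1 measurable_rot_angle)
  (measurableT_comp mh2 measurable_rot_angle) _ _ h12).
- by move=> t w; apply: mrot; rewrite cos2Dsin2.
- by move=> t f mf f0; apply: integral_area_rot; rewrite ?cos2Dsin2.
Qed.
End radial_average.

(** * Power series and the four-point mean value inequality *)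

Section modulus.
Context {R : realType}.
Implicit Types z w : R[i].

Lemma normcE z : `|z| = (cmod z)%:C. Proof. by []. Qed.

Lemma cmod_ge0 z : 0 <= cmod z. Proof. by rewrite -ler0c -normcE. Qed.

Lemma cmodM z w : cmod (z * w) = cmod z * cmod w. Proof. exact: Normc.normcM. Qed.

Lemma cmodX z n : cmod (z ^+ n) = cmod z ^+ n.
Proof. by apply: complexI; rewrite -normcE normrX rmorphXn. Qed.

Lemma cmodV z : cmod z^-1 = (cmod z)^-1. Proof. exact: Normc.normcV. Qed.

Lemma cmodD z w : cmod (z + w) <= cmod z + cmod w.
Proof. by have := ler_normD z w; rewrite !normcE -rmorphD lecR. Qed.

Lemma cmodN z : cmod (- z) = cmod z.
Proof. by apply: complexI; rewrite -!normcE normrN. Qed.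

Lemma cmod_distC z w : cmod (z - w) = cmod (w - z).
Proof. by rewrite -cmodN opprB. Qed.

Lemma cmod_eq0 z : (cmod z == 0) = (z == 0).
Proof.
apply/eqP/eqP => [|->]; [exact: Normc.eq0_normc|exact: Normc.normc0].
Qed.

Lemma cmod_gt0 z : (0 < cmod z) = (z != 0).
Proof. by rewrite lt_def cmod_ge0 andbT cmod_eq0. Qed.

Lemma cmod_dist z w : `|cmod z - cmod w| <= cmod (z - w).
Proof.
have := cmodD (z - w) w; have := cmodD (w - z) z.
by rewrite !subrK cmod_distC ler_norml => h1 h2; apply/andP; split; lra.
Qed.

Lemma cmod_real (x : R) : cmod x%:C = `|x|.
Proof. by rewrite /= expr0n /= addr0 sqrtr_sqr. Qed.

Lemma cmod1 : cmod (1 : R[i]) = 1. Proof. exact: Normc.normc1. Qed.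

Lemma cmod_i : cmod ('i : R[i]) = 1.
Proof. by rewrite /= expr0n expr1n /= add0r sqrtr1. Qed.

Lemma cmod_sum n (F : nat -> R[i]) m :
  cmod (\sum_(m <= k < n) F k) <= \sum_(m <= k < n) cmod (F k).
Proof.
elim/big_ind2 : _ => //; first by rewrite Normc.normc0.
by move=> x1 x2 y1 y2 h1 h2; apply: le_trans (cmodD _ _) (lerD h1 h2).
Qed.

Lemma cmod_ReIm (x y : R) : cmod (x +i* y) <= `|x| + `|y|.
Proof.
have -> : x +i* y = x%:C + 'i * y%:C by rewrite [LHS]complexE.
by apply: le_trans (cmodD _ _) _; rewrite cmodM cmod_i mul1r !cmod_real.
Qed.

Lemma cmod_limit_le (u : nat -> R[i]) (l c : R[i]) (B : R) (N : nat) :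
  (u : nat -> R[i]^o) @ \oo --> (l : R[i]^o) ->
  (forall n, (N <= n)%N -> cmod (u n - c) <= B) -> cmod (l - c) <= B.
Proof.
move=> /cvgrPdist_lt ul uB; apply/ler_addgt0Pr => e e0.
have /ul[M _ Mu] : 0 < e%:C :> R[i] by rewrite ltcR.
have := Mu (maxn M N) (leq_maxl _ _); rewrite /= normcE ltcR => h.
have := uB _ (leq_maxr M N).
have -> : l - c = (l - u (maxn M N)) + (u (maxn M N) - c) by rewrite addrA subrK.
move=> h2; apply: le_trans (cmodD _ _) _; rewrite addrC.
by apply: lerD => //; exact: ltW.
Qed.

Lemma cvg_series_cmod_bounded (u : nat -> R[i]) :
  cvg ((series u : nat -> R[i]^o) @ \oo) -> exists M, forall n, cmod (u n) <= M.
Proof.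
move=> /cvg_series_cvg_0 h.
have /cvg_seq_bounded/pinfty_ex_gt0[M _ Mu] : cvgn (u : nat -> R[i]^o).
  by apply/cvg_ex; exists 0.
by exists (complex.Re M) => n; have : `|u n| <= M := Mu n I; rewrite normcE lecE => /andP[].
Qed.

Lemma geometric_sum_le (q : R) n m : 0 <= q -> q <= 2^-1 ->
  \sum_(n <= k < n + m) q ^+ k <= 2 * q ^+ n.
Proof.
move=> q0 q2; apply: (@le_trans _ _ (2 * q ^+ n - 2 * q ^+ (n + m))); last first.
  by rewrite lerBlDr lerDl mulr_ge0 ?exprn_ge0.
elim: m => [|m IHm]; first by rewrite addn0 big_geq // subrr.
rewrite addnS big_nat_recr ?leq_addr //= exprS.
have := exprn_ge0 (n + m) q0; set x := q ^+ (n + m) in IHm * => x0; nra.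
Qed.

(** Convergence at the single point [z0 + s] bounds all [cmod (a k) * s ^+ k] by some [M]. For
    [cmod h < s / 2] the tail is then dominated by a geometric series of ratio [q = cmod h / s],
    whose sum from [n] on is at most [2 * M * q ^+ n]. *)
Lemma power_series_remainder (f : R[i] -> R[i]) (z0 : R[i]) (rho : R)
    (a : nat -> R[i]) : 0 < rho ->
  (forall z, cmod (z - z0) < rho ->
    (series (fun k => a k * (z - z0) ^+ k : R[i]^o)) @ \oo --> (f z : R[i]^o)) ->
  forall n, exists2 C, 0 <= C & exists2 delta, 0 < delta &
    forall h, cmod h < delta ->
      cmod (f (z0 + h) - \sum_(0 <= k < n) a k * h ^+ k) <= C * cmod h ^+ n.
Proof.
move=> rho0 fa n.
have [s s0 srho] : exists2 s, 0 < s & s < rho by exists (rho / 2); lra.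
have : cmod (z0 + s%:C - z0) < rho.
  by rewrite addrC addKr cmod_real gtr0_norm.
move=> /fa fas; have /cvg_series_cmod_bounded[M aM] := cvgP _ fas.
have M0 : 0 <= M by apply: le_trans (aM 0%N); exact: cmod_ge0.
exists (2 * M / s ^+ n); first by rewrite divr_ge0 ?mulr_ge0 // exprn_ge0 // ltW.
exists (s / 2) => [|h hs]; first by rewrite divr_gt0.
pose q : R := cmod h / s.
have q0 : 0 <= q by rewrite divr_ge0 ?cmod_ge0 // ltW.
have q2 : q <= 2^-1 by rewrite ler_pdivrMr // mulrC ltW.
have -> : 2 * M / s ^+ n * cmod h ^+ n = 2 * M * q ^+ n.
  by rewrite /q exprMn exprVn mulrA mulrAC.
have /fa : cmod (z0 + h - z0) < rho.
  rewrite addrC addKr; by apply: lt_trans hs _; lra.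
move=> /(@cmod_limit_le _ _ (\sum_(0 <= k < n) a k * h ^+ k) (2 * M * q ^+ n) n); apply.
move=> N nN; rewrite [z0 + h]addrC addrK /series /=.
rewrite (big_cat_nat (n := n)) //= addrAC subrr add0r.
apply: le_trans (cmod_sum _ _ _) _.
apply: (@le_trans _ _ (\sum_(n <= k < N) M * q ^+ k)).
  apply: ler_sum => k _; rewrite cmodM cmodX.
  have -> : cmod (a k) * cmod h ^+ k = cmod (a k * (s%:C) ^+ k) * q ^+ k.
    rewrite cmodM cmodX cmod_real gtr0_norm // -mulrA -exprMn /q.
    by rewrite mulrCA divff ?mulr1 ?gt_eqF.
  rewrite ler_wpM2r ?exprn_ge0 //.
  by have := aM k; rewrite addrC addKr.
rewrite -mulr_sumr [2 * M]mulrC -mulrA ler_wpM2l // -[N](subnKC nN).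
exact: geometric_sum_le.
Qed.
End modulus.

Section submean.
Context {R : realType}.
Implicit Types (f g : R[i] -> R[i]) (a b h z : R[i]).

Definition has_jet f a0 a1 a2 : Prop := exists2 C : R, 0 <= C & exists2 delta : R,
  0 < delta & forall h, cmod h < delta ->
    cmod (f h - (a0 + a1 * h + a2 * h ^+ 2)) <= C * cmod h ^+ 3.

Lemma has_jet_at0 f a0 a1 a2 : has_jet f a0 a1 a2 -> f 0 = a0.
Proof.
move=> [C C0 [d d0]] /(_ 0); rewrite Normc.normc0 expr0n /= mulr0 => /(_ d0).
rewrite !expr0n /= !mulr0 !addr0 => h.
apply/eqP; rewrite -subr_eq0 -cmod_eq0 eq_le cmod_ge0 andbT //.
Qed.

Lemma has_jet_rot f a0 a1 a2 w : cmod w = 1 -> has_jet f a0 a1 a2 ->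
  has_jet (fun h => f (w * h)) a0 (w * a1) (w ^+ 2 * a2).
Proof.
move=> w1 [C C0 [d d0 fd]]; exists C => //; exists d => // h hd.
have hw : cmod (w * h) = cmod h by rewrite cmodM w1 mul1r.
have := fd (w * h); rewrite hw => /(_ hd).
congr (cmod _ <= _); ring.
Qed.

Lemma has_jetM f g a0 a1 a2 b0 b1 b2 :
  has_jet f a0 a1 a2 -> has_jet g b0 b1 b2 ->
  has_jet (fun h => f h * g h)
    (a0 * b0) (a0 * b1 + a1 * b0) (a0 * b2 + a1 * b1 + a2 * b0).
Proof.
move=> [C C0 [d d0 fd]] [D D0 [e e0 ge]].
pose A := cmod a0 + cmod a1 + cmod a2; pose B := cmod b0 + cmod b1 + cmod b2.
have poly_le (c0 c1 c2 h : R[i]) : cmod h <= 1 ->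
    cmod (c0 + c1 * h + c2 * h ^+ 2) <= cmod c0 + cmod c1 + cmod c2.
  move=> h1; have h0 := cmod_ge0 h.
  apply: le_trans (cmodD _ _) _; apply: lerD.
    apply: le_trans (cmodD _ _) _; rewrite lerD2l cmodM ler_piMr ?cmod_ge0 //.
  by rewrite cmodM cmodX ler_piMr ?cmod_ge0 // exprn_ile1.
pose E := cmod (a1 * b2 + a2 * b1) + cmod (a2 * b2).
have A0 : 0 <= A by rewrite !addr_ge0 ?cmod_ge0.
have B0 : 0 <= B by rewrite !addr_ge0 ?cmod_ge0.
exists (C * (B + D) + A * D + E).
  by rewrite !addr_ge0 ?mulr_ge0 ?addr_ge0 ?cmod_ge0.
(* With [cmod h <= 1], each Taylor polynomial is bounded by the sum of the moduli of its
   coefficients, whence [A], [B] and [E]. *)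
exists (Num.min 1 (Num.min d e)); first by rewrite !lt_min ltr01 d0.
move=> h; rewrite !lt_min => /and3P[h1 hd he]; have h0 := cmod_ge0 h.
have {h1} h1 := ltW h1.
set P := a0 + a1 * h + a2 * h ^+ 2; set Q := b0 + b1 * h + b2 * h ^+ 2.
have -> : f h * g h - (a0 * b0 + (a0 * b1 + a1 * b0) * h +
      (a0 * b2 + a1 * b1 + a2 * b0) * h ^+ 2) =
    (f h - P) * g h + P * (g h - Q) + ((a1 * b2 + a2 * b1) + (a2 * b2) * h) * h ^+ 3.
  by rewrite /P /Q; ring.
have {fd} fP := fd h hd; have {ge} gQ := ge h he.
have hn : cmod h ^+ 3 <= 1 by rewrite exprn_ile1.
have hn0 : 0 <= cmod h ^+ 3 by rewrite exprn_ge0.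
have gB : cmod (g h) <= B + D.
  rewrite -(subrK Q (g h)) addrC; apply: le_trans (cmodD _ _) _; apply: lerD.
    exact: poly_le.
  by apply: le_trans gQ _; rewrite ler_piMr.
have PA : cmod P <= A by exact: poly_le.
apply: le_trans (cmodD _ _) _; rewrite [leRHS]mulrDl; apply: lerD.
  apply: le_trans (cmodD _ _) _; rewrite !cmodM [leRHS]mulrDl; apply: lerD.
    by rewrite mulrAC; apply: ler_pM; rewrite ?cmod_ge0.
  by rewrite -mulrA; apply: ler_pM; rewrite ?cmod_ge0.
rewrite cmodM cmodX ler_wpM2r //.
apply: le_trans (cmodD _ _) _; rewrite lerD2l cmodM.
by rewrite ler_piMr ?cmod_ge0.
Qed.

(** The product is unchanged when [h] is replaced by [w * h], so no term in [h] or [h ^+ 2] can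
    survive. In the computation, the second coefficient appears with the factor [w ^+ 2 + 1]. *)
Lemma has_jet_square f a0 a1 a2 (w : R[i]) : w ^+ 2 = - 1 -> cmod w = 1 ->
  has_jet f a0 a1 a2 ->
  has_jet (fun h => f h * f (- h) * f (w * h) * f (- (w * h))) (a0 ^+ 4) 0 0.
Proof.
move=> ww w1 jet.
have n1 : cmod (- 1 : R[i]) = 1 by rewrite cmodN cmod1.
have jet_neg := has_jet_rot n1 jet.
have wn1 : cmod (- w) = 1 by rewrite cmodN.
have := has_jetM (has_jetM (has_jetM jet jet_neg) (has_jet_rot w1 jet))
  (has_jet_rot wn1 jet).
set c1 := (X in has_jet _ _ X _); set c2 := (X in has_jet _ _ _ X).
have -> : c1 = 0 by rewrite /c1; ring.
have -> : c2 = (2 * a0 ^+ 3 * a2 - a0 ^+ 2 * a1 ^+ 2) * (w ^+ 2 + 1).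
  by rewrite /c2; ring.
rewrite ww addNr mulr0 => -[C C0 [d d0 fd]].
exists C => //; exists d => // h /fd.
by rewrite mulN1r mulNr (_ : a0 ^+ 4 = a0 * a0 * a0 * a0) //; ring.
Qed.

Lemma analytic_jet f z : analytic_on_disc f -> disc z ->
  exists a1 a2, has_jet (fun h => f (z + h)) (f z) a1 a2.
Proof.
move=> fa /fa[rho [a [rho0 fz]]].
have [C C0 [d d0 fd]] := power_series_remainder rho0 fz 3.
have jet : has_jet (fun h => f (z + h)) (a 0%N) (a 1%N) (a 2%N).
  exists C => //; exists d => // h /fd.
  by rewrite !big_nat_recr //= big_geq // add0r expr0 mulr1 expr1.
by exists (a 1%N), (a 2%N); move: (has_jet_at0 jet); rewrite addr0 => ->.
Qed.

(* A four-point sub-mean value inequality, up to [o(cmod h ^+ 2)].  For an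
   analytic [f], the product of [f] over the vertices [z + 'i ^+ k * h] of a square
   agrees with [f z ^+ 4] up to the third order: this is the second-order form of
   the harmonicity of [ln (cmod f)], and [1 + x <= expR x] deduces from it
   that [cmod f `^ p] is sub-mean. *)
Definition submean (u : R[i] -> R) z : Prop := forall e, 0 < e ->
  exists2 delta : R, 0 < delta & forall h, 0 < cmod h < delta ->
    4 * u z - e * cmod h ^+ 2 <=
    u (z + h) + u (z - h) + u (z + 'i * h) + u (z - 'i * h).

Lemma ln_1B_ge (y : R) : 0 <= y -> y <= 2^-1 -> - (2 * y) <= ln (1 - y).
Proof.
move=> y0 y2; have y1 : 0 < 1 - y by lra.
rewrite lerNl -lnV ?posrE //.
have -> : (1 - y)^-1 = 1 + y / (1 - y) by field; lra.
apply: le_trans (le_ln1Dx _) _.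
  by apply: (lt_le_trans (ltrN10 _)); rewrite divr_ge0 // ltW.
by rewrite ler_pdivrMr //; nra.
Qed.

Lemma powR_ge_ln (p t : R) : 0 < t -> 1 + p * ln t <= t `^ p.
Proof.
by move=> t0; rewrite /powR gt_eqF //; exact: expR_ge1Dx.
Qed.

(** Each power is at least [1 + p * ln t]. The four logarithms add up to that of the product, which
    is at least [ln (1 - y) >= - (2 * y)]. *)
Lemma sum4_powR_ge (p y : R) (t1 t2 t3 t4 : R) : 0 < p -> 0 <= y -> y <= 2^-1 ->
  0 < t1 -> 0 < t2 -> 0 < t3 -> 0 < t4 -> 1 - y <= t1 * t2 * t3 * t4 ->
  4 - p * (2 * y) <= t1 `^ p + t2 `^ p + t3 `^ p + t4 `^ p.
Proof.
move=> p0 y0 y2 t10 t20 t30 t40 yt.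
have := ln_1B_ge y0 y2.
have : ln (1 - y) <= ln (t1 * t2 * t3 * t4).
  by rewrite ler_ln ?posrE ?mulr_gt0 //; lra.
rewrite !lnM ?posrE ?mulr_gt0 // => h1 h2.
have {h1}h2 := le_trans h2 h1.
rewrite -(ler_pM2l p0) in h2.
have := powR_ge_ln p t10; have := powR_ge_ln p t20.
have := powR_ge_ln p t30; have := powR_ge_ln p t40.
lra.
Qed.

Lemma submean_analytic f z (p : R) : 0 < p -> analytic_on_disc f -> disc z ->
  submean (fun z => cmod (f z) `^ p) z.
Proof.
move=> p0 fa dz e e0; have [fz0|fz0] := eqVneq (f z) 0.
  exists 1 => // h _; rewrite fz0 Normc.normc0 powR0 ?gt_eqF // mulr0 sub0r.
  apply: le_trans (_ : 0 <= _); last by rewrite !addr_ge0 ?powR_ge0.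
  by rewrite oppr_le0 mulr_ge0 ?exprn_ge0 ?cmod_ge0 // ltW.
have [a1 [a2 jet]] := analytic_jet fa dz.
have [C C0 [d d0 fd]] := has_jet_square (sqr_i R) (cmod_i (R := R)) jet.
pose m := cmod (f z); have m0 : 0 < m by rewrite cmod_gt0.
have m40 : 0 < m ^+ 4 by rewrite exprn_gt0.
have mp0 : 0 < m `^ p by rewrite powR_gt0.
(* After normalising the four values by [m], their product misses 1 by at most
   [y = C * cmod h ^+ 3 / m ^+ 4]; [B * cmod h ^+ 3] is the resulting loss [p * (2 * y)] scaled back
   by the [p]-th power of [m]. *)
pose B : R := 2 * p * m `^ p * C / m ^+ 4.
have B0 : 0 <= B by rewrite /B !mulr_ge0 ?invr_ge0 // ltW.
(* [C * k <= m ^+ 4 / 2] ensures [y <= 2^-1], and [B * k <= e] absorbs the cubic loss into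
   [e * cmod h ^+ 2]. *)
have [k k0 [kd k1 kC kB]] : exists2 k, 0 < k &
    [/\ k <= d, k <= 1, C * k <= m ^+ 4 / 2 & B * k <= e].
  exists (Num.min (Num.min d 1) (Num.min (m ^+ 4 / 2 / (C + 1)) (e / (B + 1)))).
    by rewrite !lt_min d0 ltr01 /= !divr_gt0 // ltr_wpDl.
  have C1 : 0 < C + 1 by lra.
  have B1 : 0 < B + 1 by lra.
  set k := Num.min _ _.
  have : k <= d by rewrite /k !ge_min lexx.
  have : k <= 1 by rewrite /k !ge_min lexx orbT.
  have k1 : k <= m ^+ 4 / 2 / (C + 1) by rewrite /k !ge_min lexx !orbT.
  have k2 : k <= e / (B + 1) by rewrite /k !ge_min lexx !orbT.
  have k0 : 0 <= k.
    by rewrite /k !le_min (ltW d0) ler01 /= !divr_ge0 // ?ltW // divr_ge0 // ltW.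
  move: k1 k2; rewrite !ler_pdivlMr // => k1 k2; split => //; nra.
exists k => // h /andP[h0 hk].
have hd : cmod h < d by apply: lt_le_trans hk kd.
have h1 : cmod h <= 1 by apply/ltW/(lt_le_trans hk).
have := fd h hd; rewrite !mul0r !addr0 => {fd} fd.
pose y := C * cmod h ^+ 3 / m ^+ 4.
have y0 : 0 <= y by rewrite /y !mulr_ge0 ?invr_ge0 ?exprn_ge0 ?cmod_ge0 // ltW.
have h32 : cmod h ^+ 3 <= k * cmod h ^+ 2.
  by rewrite exprS ler_wpM2r ?exprn_ge0 ?cmod_ge0 // ltW.
have h2 : cmod h ^+ 2 <= 1 by rewrite exprn_ile1 // cmod_ge0.
have h3k : cmod h ^+ 3 <= k by apply: le_trans h32 _; rewrite ler_piMr // ltW.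
have y2 : y <= 2^-1.
  rewrite /y ler_pdivrMr // [leRHS]mulrC; apply: le_trans kC.
  by rewrite ler_wpM2l.
set f1 := f (z + h); set f2 := f (z - h); set f3 := f (z + 'i * h); set f4 := f (z - 'i * h).
have P4 : 1 - y <= cmod f1 / m * (cmod f2 / m) * (cmod f3 / m) * (cmod f4 / m).
  have -> : cmod f1 / m * (cmod f2 / m) * (cmod f3 / m) * (cmod f4 / m) =
      cmod (f1 * f2 * f3 * f4) / m ^+ 4.
    by rewrite !cmodM; field; rewrite gt_eqF.
  have -> : 1 - y = (m ^+ 4 - C * cmod h ^+ 3) / m ^+ 4.
    by rewrite /y; field; rewrite gt_eqF.
  rewrite ler_wpM2r ?invr_ge0 ?(ltW m40) // /m -cmodX.
  have := cmodD (f z ^+ 4 - f1 * f2 * f3 * f4) (f1 * f2 * f3 * f4).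
  by rewrite subrK; move: fd; rewrite cmod_distC; lra.
have Pm0 : 0 < cmod f1 / m * (cmod f2 / m) * (cmod f3 / m) * (cmod f4 / m).
  by apply: lt_le_trans P4; lra.
have pos (t : R[i]) : t != 0 -> 0 < cmod t / m by move=> t0; rewrite divr_gt0 // cmod_gt0.
have : f1 * f2 * f3 * f4 != 0.
  apply: contraTneq Pm0 => e0'; rewrite -leNgt.
  have -> : cmod f1 / m * (cmod f2 / m) * (cmod f3 / m) * (cmod f4 / m) =
      cmod (f1 * f2 * f3 * f4) / m ^+ 4.
    by rewrite !cmodM; field; rewrite gt_eqF.
  by rewrite e0' Normc.normc0 mul0r.
rewrite !mulf_eq0 !negb_or => /andP[/andP[/andP[f10 f20] f30] f40].
have := sum4_powR_ge p0 y0 y2 (pos _ f10) (pos _ f20) (pos _ f30) (pos _ f40) P4.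
rewrite -(ler_pM2l mp0) !mulrDr.
have cancel t : m `^ p * (cmod t / m) `^ p = cmod t `^ p.
  by rewrite -powRM ?divr_ge0 ?cmod_ge0 ?(ltW m0) // mulrC divfK ?gt_eqF.
have mpy : m `^ p * (p * (2 * y)) = B * cmod h ^+ 3 by rewrite /B /y; ring.
have Bh : B * cmod h ^+ 3 <= e * cmod h ^+ 2.
  apply: (@le_trans _ _ (B * (k * cmod h ^+ 2))); first by rewrite ler_wpM2l.
  by rewrite mulrA ler_wpM2r ?exprn_ge0 ?cmod_ge0.
rewrite !cancel -/m mulrN mpy mulr1; lra.
Qed.
End submean.

(** * The maximum principle *)

Section continuity.
Context {R : realType}.
Implicit Types (u v : R[i] -> R) (z w : R[i]).

(** Continuity is expressed in real coordinates, the form in which compactness of the closed disc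
    and measurability on the plane are used. *)
Definition continuous_atC v z : Prop :=
  v (q.1 +i* q.2) @[q --> (complex.Re z, complex.Im z)] -->
  v (complex.Re z +i* complex.Im z).

Lemma continuous_atC_cmod v z :
  (forall e, 0 < e -> exists2 delta : R, 0 < delta &
    forall h, cmod h < delta -> `|v (z + h) - v z| < e) -> continuous_atC v z.
Proof.
case: z => x y vz; apply/cvgrPdist_lt => e /vz[d d0 vd] /=.
have d20 : 0 < d / 2 by lra.
near=> w; rewrite distrC.
have -> : w.1 +i* w.2 = (x +i* y) + ((w.1 - x) +i* (w.2 - y)) by simpc; rewrite !subrKC.
apply: vd; apply: le_lt_trans (cmod_ReIm _ _) _.
have w1 : `|x - w.1| < d / 2.
  near: w; have /cvgrPdist_lt : w.1 @[w --> (x, y)] --> x by exact: cvg_fst.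
  exact.
have w2 : `|y - w.2| < d / 2.
  near: w; have /cvgrPdist_lt : w.2 @[w --> (x, y)] --> y by exact: cvg_snd.
  exact.
rewrite distrC in w1; rewrite distrC in w2; lra.
Unshelve. all: by end_near. Qed.

Lemma continuous_atC_sum (N : nat) (v : nat -> R[i] -> R) z :
  (forall k, continuous_atC (v k) z) ->
  continuous_atC (fun z => \sum_(0 <= k < N) v k z) z.
Proof.
move=> vz; rewrite /continuous_atC; elim: N => [|N IHN].
  by under eq_cvg do rewrite big_geq //; rewrite big_geq //; exact: cvg_cst.
under eq_cvg do rewrite big_nat_recr //=.
by rewrite big_nat_recr //=; apply: cvgD; [exact: IHN|exact: vz].
Qed.

Lemma continuous_atC_comp v w z : continuous_atC v (w * z) ->
  continuous_atC (fun z => v (w * z)) z.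
Proof.
case: w z => a b [x y] vwz; rewrite /continuous_atC.
have v1 : a * q.1 - b * q.2 @[q --> (x, y)] --> a * x - b * y.
  by apply: cvgB; apply: cvgM; (exact: cvg_cst || exact: cvg_fst || exact: cvg_snd).
have v2 : a * q.2 + b * q.1 @[q --> (x, y)] --> a * y + b * x.
  by apply: cvgD; apply: cvgM; (exact: cvg_cst || exact: cvg_fst || exact: cvg_snd).
have vg : (a * q.1 - b * q.2, a * q.2 + b * q.1) @[q --> (x, y)] -->
    (a * x - b * y, a * y + b * x) by exact: (cvg_pair v1 v2).
exact: (cvg_comp _ _ vg vwz).
Qed.

(** At a positive limit the power map is differentiable. At 0 it is not when [p < 1], so that case
    is done by hand: keeping [g] below the power [p^-1] of [e] keeps its [p]-th power below [e]. *)
Lemma cvg_powR {T} (F : set_system T) {FF : Filter F} (g : T -> R) (x p : R) :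
  0 < p -> 0 <= x -> (forall t, 0 <= g t) -> g t @[t --> F] --> x ->
  g t `^ p @[t --> F] --> x `^ p.
Proof.
move=> p0; rewrite le_eqVlt => /predU1P[<-|x0] g0 gx; last first.
  have : {for x, continuous (fun a => a `^ p)}.
    apply/differentiable_continuous/derivable1_diffP.
    by apply: derivable_powR; rewrite in_itv /= x0.
  by move=> px; exact: (cvg_comp _ _ gx px).
rewrite powR0 ?gt_eqF //; apply/cvgr0Pnorm_lt => e e0.
have : \near F, `|g F| < e `^ p^-1.
  by move: gx => /cvgr0Pnorm_lt; apply; rewrite powR_gt0.
apply: filterS => t; rewrite !ger0_norm ?powR_ge0 // => gt.
rewrite -[e](powRr1 (ltW e0)) -(@mulVf _ p) ?gt_eqF // powRrM.
by apply: gt0_ltr_powR; rewrite ?nnegrE ?powR_ge0.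
Qed.

Lemma analytic_continuous f z (c : R[i]) (p : R) : 0 < p ->
  analytic_on_disc f -> disc z -> continuous_atC (fun z => cmod (f z - c) `^ p) z.
Proof.
move=> p0 fa dz; apply: cvg_powR => // [|t|]; rewrite ?cmod_ge0 //.
apply: (@continuous_atC_cmod (fun z => cmod (f z - c))) => e e0.
have [rho [a [rho0 fz]]] := fa z dz.
have [C C0 [d d0 fd]] := power_series_remainder rho0 fz 1.
have C1 : 0 < C + 1 by lra.
have fz0 : f z = a 0%N.
  have := fd 0; rewrite Normc.normc0 => /(_ d0).
  rewrite big_nat1 expr0 mulr1 addr0 expr1 mulr0 => h.
  by apply/eqP; rewrite -subr_eq0 -cmod_eq0 eq_le cmod_ge0 h.
exists (Num.min d (e / (C + 1))); first by rewrite lt_min d0 divr_gt0.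
move=> h; rewrite lt_min => /andP[hd]; rewrite ltr_pdivlMr // => he.
have := fd h hd; rewrite big_nat1 expr0 mulr1 expr1 -fz0 => fh.
apply: le_lt_trans (cmod_dist _ _) _.
rewrite opprB addrA subrK; apply: le_lt_trans fh _.
by have := cmod_ge0 h; lra.
Qed.
Lemma analytic_continuous_cmod f z (p : R) : 0 < p ->
  analytic_on_disc f -> disc z -> continuous_atC (fun z => cmod (f z) `^ p) z.
Proof.
move=> p0 fa dz; have := @analytic_continuous f z 0 p p0 fa dz.
rewrite (_ : (fun w => cmod (f w - 0) `^ p) = (fun w => cmod (f w) `^ p)) //.
by apply/funext => v; rewrite subr0.
Qed.
End continuity.

Arguments Normc.normc : simpl never.

Section maximum_principle.
Context {R : realType}.
Implicit Types (u v : R[i] -> R) (z w : R[i]).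

(** Finiteness is essential: the radius for the sum is the minimum of the radii of the summands, and
    the error [e] is shared among them. *)
Lemma submean_sum (N : nat) (v : nat -> R[i] -> R) z :
  (forall k, submean (v k) z) -> submean (fun z => \sum_(0 <= k < N) v k z) z.
Proof.
move=> vz; elim: N => [|N IHN] e e0.
  exists 1 => // h _; rewrite !big_geq // mulr0 sub0r !addr0 oppr_le0.
  by rewrite mulr_ge0 ?exprn_ge0 ?cmod_ge0 // ltW.
have e2 : 0 < e / 2 by lra.
have [c c0 hc] := IHN _ e2; have [d d0 hd] := vz N _ e2.
exists (Num.min c d); first by rewrite lt_min c0.
move=> h /andP[h0]; rewrite lt_min => /andP[h1 h2].
have := hc h; rewrite h0 h1 => /(_ isT).
have := hd h; rewrite h0 h2 => /(_ isT).
rewrite !big_nat_recr //=; lra.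
Qed.

Lemma submean_rot v z w : cmod w = 1 -> submean v (w * z) ->
  submean (fun z => v (w * z)) z.
Proof.
move=> w1 vz e e0; have [d d0 vd] := vz e e0; exists d => // h hd.
have hw : cmod (w * h) = cmod h by rewrite cmodM w1 mul1r.
have := vd (w * h); rewrite hw => /(_ hd).
by rewrite !mulrDr !mulrN ![w * ('i * h)]mulrCA.
Qed.

Lemma cmodE (x y : R) : cmod (x +i* y) ^+ 2 = x ^+ 2 + y ^+ 2.
Proof. by rewrite sqr_sqrtr // addr_ge0 ?sqr_ge0. Qed.

Lemma sum4_cmod_sqr z (h : R[i]) :
  cmod (z + h) ^+ 2 + cmod (z - h) ^+ 2 + cmod (z + 'i * h) ^+ 2 +
  cmod (z - 'i * h) ^+ 2 = 4 * cmod z ^+ 2 + 4 * cmod h ^+ 2.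
Proof.
case: z h => x y [a b].
by simpc; rewrite !cmodE; ring.
Qed.

Lemma continuous_cmod2 (q : R * R) :
  {for q, continuous (fun q : R * R => cmod (q.1 +i* q.2) ^+ 2)}.
Proof.
case: q => x y.
suff : cmod (q.1 +i* q.2) ^+ 2 @[q --> (x, y)] --> cmod (x +i* y) ^+ 2 by [].
under eq_cvg do rewrite cmodE !expr2; rewrite cmodE !expr2.
by apply: cvgD; apply: cvgM; (exact: cvg_fst || exact: cvg_snd).
Qed.

Lemma compact_closed_disc (r : R) :
  compact [set q : R * R | cmod (q.1 +i* q.2) <= r].
Proof.
apply: (@subclosed_compact _ _ (`[- r, r]%classic `*` `[- r, r]%classic)).
- have [r0|r0] := leP 0 r; last first.
    rewrite (_ : [set _ | _] = set0); first exact: closed0.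
    apply/seteqP; split => // q /= h.
    by have := le_lt_trans (le_trans (cmod_ge0 _) h) r0; rewrite ltxx.
  rewrite (_ : [set _ | _] =
    (fun q : R * R => cmod (q.1 +i* q.2) ^+ 2) @^-1` [set x | x <= r ^+ 2]).
    apply: preimage_closed; last exact: closed_le.
    by move=> q _; exact: continuous_cmod2.
  by apply/seteqP; split => q /=; rewrite ler_pXn2r ?nnegrE ?cmod_ge0.
- by apply: compact_setX; exact: segment_compact.
- move=> [x y] /= xyr; split => /=; rewrite in_itv /= -ler_norml;
    apply: le_trans xyr; rewrite -sqrtr_sqr ler_wsqrtr // ?lerDl ?lerDr sqr_ge0 //.
Qed.

Lemma maximum_principle v (r M : R) :
  (forall z, cmod z <= r -> continuous_atC v z) ->
  (forall z, cmod z < r -> submean v z) ->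
  (forall z, cmod z = r -> v z <= M) ->
  forall z, cmod z <= r -> v z <= M.
Proof.
(* Adding [e * cmod z ^+ 2], whose four-point mean at [c] exceeds its value by
   [e * cmod h ^+ 2], makes the sub-mean inequality strict. *)
move=> vc vs vM z zr; apply/ler_addgt0Pr => e' e'0.
have r0 : 0 <= r by apply: le_trans zr; exact: cmod_ge0.
have [e e0 er] : exists2 e : R, 0 < e & e * r ^+ 2 <= e'.
  exists (e' / (r ^+ 2 + 1)); first by rewrite divr_gt0 // ltr_wpDl ?sqr_ge0.
  rewrite mulrAC ler_pdivrMr ?ltr_wpDl ?sqr_ge0 //.
  by rewrite ler_wpM2l ?(ltW e'0) // lerDl.
pose g (q : R * R) : R := v (q.1 +i* q.2) + e * cmod (q.1 +i* q.2) ^+ 2.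
pose A := [set q : R * R | cmod (q.1 +i* q.2) <= r].
have zE (t : R[i]) : complex.Re t +i* complex.Im t = t by case: t.
have A0 : A !=set0 by exists (complex.Re z, complex.Im z); rewrite /A /= zE.
have gc : {within A, continuous g}.
  apply: continuous_in_subspaceT => -[x y]; rewrite inE /A /= => /vc vxy.
  apply: cvgD; first exact: vxy.
  by apply: cvgM; [exact: cvg_cst|exact: continuous_cmod2].
have [[x y]] := compact_EVT_max A0 (compact_closed_disc (r := r)) gc.
rewrite inE /A /= => xyr gmax; set c := x +i* y in xyr.
have {}gmax (t : R[i]) : cmod t <= r -> v t + e * cmod t ^+ 2 <= v c + e * cmod c ^+ 2.
  move=> tr; have := gmax (complex.Re t, complex.Im t).
  by rewrite inE /A /g /= zE => /(_ tr).
have cr : cmod c = r.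
  apply/eqP; rewrite eq_le xyr leNgt; apply/negP => cr.
  have [d d0 vd] := vs c cr e e0.
  have [k k0 [kd kr]] : exists2 k, 0 < k & k < d /\ k < r - cmod c.
    exists (Num.min d (r - cmod c) / 2).
      by rewrite divr_gt0 // lt_min d0 subr_gt0.
    have m0 : 0 < Num.min d (r - cmod c) by rewrite lt_min d0 subr_gt0.
    have := lexx (Num.min d (r - cmod c)); rewrite le_min => /andP[m1 m2].
    by split; lra.
  have kc : cmod k%:C = k by rewrite cmod_real gtr0_norm.
  have := vd k%:C; rewrite kc k0 kd => /(_ isT).
  have ik : cmod ('i * k%:C) = k by rewrite cmodM cmod_i mul1r.
  have inr (t : R[i]) : cmod t = k -> cmod (c + t) <= r.
    by move=> tk; apply: le_trans (cmodD _ _) _; rewrite tk; lra.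
  have := gmax _ (inr _ kc); have := gmax (c - k%:C); rewrite inr ?cmodN // => /(_ isT).
  have := gmax _ (inr _ ik); have := gmax (c - 'i * k%:C); rewrite inr ?cmodN // => /(_ isT).
  have := sum4_cmod_sqr c k%:C; rewrite kc.
  have : 0 < e * k ^+ 2 by rewrite mulr_gt0 ?exprn_gt0.
  set a1 := cmod (c + _) ^+ 2; set a2 := cmod (c - _) ^+ 2.
  set a3 := cmod (c + 'i * _) ^+ 2; set a4 := cmod (c - 'i * _) ^+ 2.
  move=> ek s h1 h2 h3 h4.
  (* The four values of the perturbed function sum to at least four times its value at [c] plus
     [3 * e * k ^+ 2]: a gain of [4 * e * k ^+ 2] from the square modulus against a loss of
     [e * k ^+ 2] in the sub-mean inequality. This contradicts maximality. *)
  have : e * (a1 + a2 + a3 + a4) = e * (4 * cmod c ^+ 2 + 4 * k ^+ 2) by rewrite s.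
  rewrite !mulrDr; lra.
have := gmax z zr; have := vM c cr; rewrite cr.
have : 0 <= e * cmod z ^+ 2 by rewrite mulr_ge0 ?exprn_ge0 ?cmod_ge0 // ltW.
lra.
Qed.
End maximum_principle.

(** * Circular means *)

Section riemann_sums.
Context {R : realType}.
Implicit Types (phi Phi : R -> R) (a b x h e : R).
Local Notation leb := (@lebesgue_measure R).

Lemma uniform_continuity_segment phi a b e : continuous phi -> 0 < e ->
  exists2 d, 0 < d & forall x y, a <= x <= b -> `|x - y| < d ->
    `|phi x - phi y| < e.
Proof.
move=> cphi e0.
have /compact_near_coveringP := segment_compact (a := a) (b := b).
move=> /(_ R 0^'+ (fun d x => forall y, `|x - y| < d -> `|phi x - phi y| < e) _).
case=> [x _|d /= d0 dP].
  have e2 : 0 < e / 2 by lra.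
  have /cvgrPdist_lt/(_ _ e2)/nbhs_ballP[r /= r0 rP] := cphi x.
  have r2 : 0 < r / 2 by lra.
  near=> x' d => /= y x'y.
  have x'x : `|x - x'| < r / 2 by near: x'; apply: nbhsx_ballx.
  have dr : d < r / 2 by near: d; exact: nbhs_right_lt.
  have xy : `|x - y| < r.
    rewrite -(subrKA x'); apply: le_lt_trans (ler_normD _ _) _; lra.
  have h1 : `|phi x - phi x'| < e / 2 by apply: rP; rewrite /ball /=; lra.
  have h2 : `|phi x - phi y| < e / 2 by exact: rP.
  rewrite -(subrKA (phi x)); apply: le_lt_trans (ler_normD _ _) _.
  by rewrite distrC in h1; lra.
exists (d / 2); first by rewrite divr_gt0.
move=> x y xab xy; apply: (dP (d / 2)) => //=; last by rewrite divr_gt0.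
by rewrite sub0r normrN ger0_norm; lra.
Unshelve. all: by end_near. Qed.

Lemma exists_antiderivative phi a b : continuous phi ->
  exists Phi, forall x, a < x < b -> is_derive x 1 Phi (phi x).
Proof.
move=> cphi; exists (fun x => \int[leb]_(t in `[a, x]) phi t) => x /andP[ax xb].
have iphi : leb.-integrable `[a, b] (EFin \o phi).
  apply: continuous_compact_integrable; first exact: segment_compact.
  exact: continuous_subspaceT.
have [dx dE] := continuous_FTC1_closed xb iphi ax (cphi x).
by split; [exact: dx|rewrite -derive1E; exact: dE].
Qed.

Lemma is_derive_continuous Phi x (l : R) : is_derive x 1 Phi l ->
  {for x, continuous Phi}.
Proof.
by move=> dx; apply/differentiable_continuous/derivable1_diffP; exact: ex_derive.
Qed.

Lemma integral_antiderivative phi Phi a b : a < b -> continuous phi ->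
  (forall x, a <= x <= b -> is_derive x 1 Phi (phi x)) ->
  (\int[leb]_(x in `[a, b]) (phi x)%:E = (Phi b - Phi a)%:E)%E.
Proof.
move=> ab cphi dPhi; rewrite EFinB; apply: continuous_FTC2 => //.
- exact: continuous_subspaceT.
- split.
  + move=> x; rewrite in_itv /= => /andP[ax xb].
    by apply: (@ex_derive _ _ _ _ _ _ _ (dPhi x _)); rewrite !ltW.
  + by apply/cvg_at_right_filter/(is_derive_continuous (dPhi _ _)); rewrite lexx ltW.
  + by apply/cvg_at_left_filter/(is_derive_continuous (dPhi _ _)); rewrite lexx ltW.
- move=> x; rewrite in_itv /= => /andP[ax xb]; rewrite derive1E.
  by apply: (@derive_val _ _ _ _ _ _ _ (dPhi x _)); rewrite !ltW.
Qed.

Lemma antiderivative_MVT phi Phi a b : a <= b ->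
  (forall x, a <= x <= b -> is_derive x 1 Phi (phi x)) ->
  exists2 c, a <= c <= b & Phi b - Phi a = phi c * (b - a).
Proof.
move=> ab dPhi; have [||c] := @MVT_segment R Phi phi a b ab.
- by move=> x; rewrite in_itv /= => /andP[? ?]; apply: dPhi; rewrite !ltW.
- apply: continuous_in_subspaceT => x; rewrite inE /= in_itv /= => xab.
  exact: is_derive_continuous (dPhi _ xab).
by rewrite in_itv /=; exists c.
Qed.

(** On each cell the mean value theorem turns the increment of [Phi] into [h * phi c] with [c] in
    the cell, so replacing [c] by the left end costs at most [h * e]. *)
Lemma riemann_sum_dist phi Phi x h e N : 0 <= h ->
  (forall y, x <= y <= x + h *+ N -> is_derive y 1 Phi (phi y)) ->
  (forall s t, x <= s <= x + h *+ N -> `|s - t| <= h -> `|phi s - phi t| <= e) ->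
  `|h * (\sum_(0 <= k < N) phi (x + h *+ k)) - (Phi (x + h *+ N) - Phi x)|
    <= (h * e) *+ N.
Proof.
move=> h0; elim: N => [|N IHN] dPhi phie.
  by rewrite big_geq // mulr0 mulr0n addr0 subrr subr0 normr0.
have xN : x + h *+ N <= x + h *+ N.+1 by rewrite lerD2l mulrS lerDr.
have xN0 : x <= x + h *+ N by rewrite lerDl mulrn_wge0.
have {}IHN : `|h * (\sum_(0 <= k < N) phi (x + h *+ k)) -
    (Phi (x + h *+ N) - Phi x)| <= (h * e) *+ N.
  apply: IHN => [y /andP[h1 h2]|s t /andP[h1 h2]].
    by apply: dPhi; rewrite h1 (le_trans h2).
  by apply: phie; rewrite h1 (le_trans h2).
have [|c /andP[c1 c2] PhiE] := @antiderivative_MVT phi Phi _ _ xN.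
  by move=> y /andP[h1 h2]; apply: dPhi; rewrite h2 (le_trans xN0).
have cx : `|phi (x + h *+ N) - phi c| <= e.
  apply: phie; first by rewrite xN0.
  by rewrite distrC ger0_norm ?subr_ge0 // lerBlDl; move: c2; rewrite mulrSr addrA.
rewrite big_nat_recr //= mulrDr.
have -> : Phi (x + h *+ N.+1) - Phi x =
    (Phi (x + h *+ N) - Phi x) + h * phi c.
  have -> : h * phi c = Phi (x + h *+ N.+1) - Phi (x + h *+ N).
    by rewrite PhiE mulrSr; ring.
  by ring.
rewrite opprD addrACA mulrSr; apply: le_trans (ler_normD _ _) (lerD IHN _).
by rewrite -mulrBr normrM ger0_norm // ler_wpM2l.
Qed.
End riemann_sums.

Section circular_means.
Context {R : realType}.
Implicit Types (phi : R -> R) (u : R[i] -> R) (z w : R[i]) (e t : R).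
Local Notation leb := (@lebesgue_measure R).

Definition expi t : R[i] := cos t +i* sin t.

Lemma expiD s t : expi (s + t) = expi s * expi t.
Proof. by rewrite /expi cosD sinD; simpc; congr (_ +i* _); ring. Qed.

Lemma cmod_expi t : cmod (expi t) = 1.
Proof. by rewrite /expi /Normc.normc cos2Dsin2 sqrtr1. Qed.

Lemma expi0 : expi 0 = 1.
Proof. by rewrite /expi cos0 sin0. Qed.

Lemma expiD2pi t : expi (t + 2 * pi) = expi t.
Proof. by rewrite /expi mulr_natl cosD2pi sinD2pi. Qed.

Lemma circle_pointE r t : circle_point r t = expi t * r%:C.
Proof. by rewrite /circle_point /expi; simpc; congr (_ +i* _); ring. Qed.

Lemma expi_surj w : cmod w = 1 -> exists2 t, 0 <= t <= 2 * pi & w = expi t.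
Proof.
case: w => c s w1; have cs : c ^+ 2 + s ^+ 2 = 1.
  by rewrite -cmodE w1 expr1n.
have c1 : -1 <= c <= 1.
  rewrite -ler_norml -(@ler_pXn2r _ 2) ?nnegrE // expr1n real_normK ?num_real //.
  by rewrite -cs lerDl sqr_ge0.
have acosc : cos (acos c) = c by apply: acosK; rewrite in_itv.
have a0 := acos_ge0 c1; have api := acos_lepi c1.
have sin_a : sin (acos c) = `|s|.
  by rewrite sin_acos // -cs addrC addKr sqrtr_sqr.
have [s0|s0] := leP 0 s.
  exists (acos c); first by rewrite a0; lra.
  by rewrite /expi acosc sin_a ger0_norm.
exists (2 * pi - acos c); first by apply/andP; split; lra.
rewrite /expi addrC mulr_natl cosD2pi sinD2pi cosN sinN acosc sin_a.
by rewrite ltr0_norm // opprK.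
Qed.

Lemma continuous_expi u z :
  (forall t, continuous_atC u (expi t * z)) -> continuous (fun t => u (expi t * z)).
Proof.
case: z => x y uc t; have := uc t; rewrite /continuous_atC /expi; simpc => /= uct.
have v1 : cos t * x - sin t * y @[t --> t] --> cos t * x - sin t * y.
  by apply: cvgB; apply: cvgM; (exact: cvg_cst || exact: continuous_cos || exact: continuous_sin).
have v2 : cos t * y + sin t * x @[t --> t] --> cos t * y + sin t * x.
  by apply: cvgD; apply: cvgM; (exact: cvg_cst || exact: continuous_cos || exact: continuous_sin).
have vg : (cos t * x - sin t * y, cos t * y + sin t * x) @[t --> t] -->
  (cos t * x - sin t * y, cos t * y + sin t * x) by exact: (cvg_pair v1 v2).
exact: (cvg_comp _ _ vg uct).
Qed.

(** [N0] is uniform in the starting angle [a]: the maximum principle needs the bound at all points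
    of the boundary circle for one and the same [N]. *)
Lemma circle_riemann phi : continuous phi -> (forall t, phi (t + 2 * pi) = phi t) ->
  exists2 J : R, (\int[leb]_(t in `[0%R, (2 * pi)%R]) (phi t)%:E = J%:E)%E &
  forall e, 0 < e -> exists N0 : nat, forall N, (N0 <= N)%N -> (0 < N)%N ->
    forall a, 0 <= a <= 2 * pi ->
    `|2 * pi / N%:R * \sum_(0 <= k < N) phi (a + 2 * pi / N%:R *+ k) - J| <= e.
Proof.
move=> cphi per; have pi0 := pi_gt0 R; set T : R := 2 * pi.
have T0 : 0 < T by rewrite /T; lra.
(* [[0, T + T]] contains every period starting in [[0, T]]; the margin of 1 on both sides makes
   [Phi] differentiable at its end points as well. *)
have [Phi dPhi'] := exists_antiderivative (- 1) (T + T + 1) cphi.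
have dPhi x : 0 <= x <= T + T -> is_derive x 1 Phi (phi x).
  by move=> /andP[h1 h2]; apply: dPhi'; apply/andP; split; lra.
exists (Phi T - Phi 0).
  apply: integral_antiderivative => // x /andP[h1 h2]; apply: dPhi.
  by apply/andP; split; lra.
have shift a : 0 <= a <= T -> Phi (a + T) - Phi a = Phi T - Phi 0.
  move=> /andP[a0 aT].
  (* By periodicity [G] has derivative 0, so the integral over a period does not depend on where it
     starts. *)
  pose G x := Phi (x + T) - Phi x.
  have [|c _] := @antiderivative_MVT R (fun=> 0) G 0 a a0.
    move=> x /andP[x0 xa]; rewrite -(subrr (phi x)) -{1}(per x).
    apply: is_deriveB; last by apply: dPhi; apply/andP; split; lra.
    have dT : is_derive (x + T) 1 Phi (phi (x + T)).
      by apply: dPhi; apply/andP; split; lra.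
    have := @is_derive1_comp _ Phi (shift T) x _ _ dT (is_derive_shift x 1 T).
    by rewrite mulr1.
  by rewrite mul0r /G add0r => /eqP; rewrite subr_eq0 => /eqP.
move=> e e0; have eT : 0 < e / T by rewrite divr_gt0.
have [d d0 dP] := uniform_continuity_segment 0 (T + T) cphi eT.
exists (Num.truncn (T / d)).+1 => N N0 N1 a aT; set h := T / N%:R.
have NR : 0 < N%:R :> R by rewrite ltr0n.
have h0 : 0 < h by rewrite divr_gt0.
have hN : h *+ N = T by rewrite -mulr_natr divfK // gt_eqF.
have hd : h < d.
  rewrite ltr_pdivrMr // mulrC -ltr_pdivrMr //.
  by apply: lt_le_trans (truncnS_gt _) _; rewrite ler_nat.
have [a0 aT'] := andP aT.
have := @riemann_sum_dist R phi Phi a h (e / T) N (ltW h0); rewrite hN shift //.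
have -> : (h * (e / T)) *+ N = e by rewrite -mulrnAl hN mulrC divfK // gt_eqF.
apply.
- by move=> y /andP[y1 y2]; apply: dPhi; apply/andP; split; lra.
- move=> s t /andP[s1 s2] st; apply/ltW/dP; first by apply/andP; split; lra.
  exact: le_lt_trans hd.
Qed.

(** With [T = 2 * pi], the quantity [T / N%:R * v z] is a Riemann sum on the circle through [z],
    whose starting angle is that of [z]. On the outer circle it is at most [I + e / 2] everywhere,
    hence so it is at [r%:C * z0] by the maximum principle, while there it is at least
    [J - e / 2]. *)
Lemma circle_integral_mono u z0 (r : R) : 0 <= r <= 1 ->
  (forall z, cmod z <= cmod z0 -> continuous_atC u z) ->
  (forall z, cmod z < cmod z0 -> submean u z) ->
  (\int[leb]_(t in `[0%R, (2 * pi)%R]) (u (expi t * (r%:C * z0)))%:E <=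
   \int[leb]_(t in `[0%R, (2 * pi)%R]) (u (expi t * z0))%:E)%E.
Proof.
move=> /andP[r0 r1] uc us; have pi0 := pi_gt0 R.
have mulz0 w : cmod w <= 1 -> cmod (w * z0) <= cmod z0.
  by move=> w1; rewrite cmodM ler_piMl ?cmod_ge0.
have rz : cmod (r%:C * z0) <= cmod z0 by apply: mulz0; rewrite cmod_real ger0_norm.
have cont z : cmod z <= cmod z0 -> continuous (fun t => u (expi t * z)).
  move=> zz0; apply: continuous_expi => t; apply: uc.
  by rewrite cmodM cmod_expi mul1r.
have per z t : u (expi (t + 2 * pi) * z) = u (expi t * z) by rewrite expiD2pi.
have [J -> Jsum] := circle_riemann (cont _ rz) (per _).
have [I -> Isum] := circle_riemann (cont _ (lexx _)) (per _).
rewrite lee_fin; apply/ler_addgt0Pr => e e0.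
have e2 : 0 < e / 2 by lra.
have [N1 JN] := Jsum _ e2; have [N2 IN] := Isum _ e2.
pose N := (maxn N1 N2).+1.
have N1N : (N1 <= N)%N by apply: leqW; exact: leq_maxl.
have N2N : (N2 <= N)%N by apply: leqW; exact: leq_maxr.
have NR : 0 < N%:R :> R by rewrite ltr0n.
set T : R := 2 * pi in JN IN *; have T0 : 0 < T by rewrite /T; lra.
have h0 : 0 < T / N%:R by rewrite divr_gt0.
pose v z := \sum_(0 <= k < N) u (expi (T / N%:R *+ k) * z).
have vE a z : v (expi a * z) = \sum_(0 <= k < N) u (expi (a + T / N%:R *+ k) * z).
  by apply: eq_bigr => k _; rewrite addrC expiD mulrA.
have rot k z : cmod (expi (T / N%:R *+ k) * z) = cmod z.
  by rewrite cmodM cmod_expi mul1r.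
have vmax : v (r%:C * z0) <= (I + e / 2) / (T / N%:R).
  apply: (@maximum_principle R v (cmod z0)) => // z zz0.
  - have uk k : continuous_atC (fun z => u (expi (T / N%:R *+ k) * z)) z.
      by apply/continuous_atC_comp/uc; rewrite rot.
    exact: (@continuous_atC_sum R N (fun k z => u (expi (T / N%:R *+ k) * z)) z uk).
  - have uk k : submean (fun z => u (expi (T / N%:R *+ k) * z)) z.
      by apply: submean_rot; [exact: cmod_expi|apply: us; rewrite rot].
    exact: (submean_sum N uk).
  - have [a aT ->] : exists2 a, 0 <= a <= T & z = expi a * z0.
      (* An angle is read off from [z / z0]; when [z0 = 0] the circle is a single point and any
         angle will do. *)
      have [z00|z00] := eqVneq z0 0.
        exists 0; first by rewrite lexx ltW.
        move: zz0; rewrite z00 Normc.normc0 => /eqP; rewrite cmod_eq0 => /eqP ->.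
        by rewrite mulr0.
      have [|a aT za] := @expi_surj (z / z0).
        by rewrite cmodM cmodV zz0 divff // cmod_eq0.
      by exists a => //; rewrite -za divfK.
    rewrite vE ler_pdivlMr // mulrC.
    have := IN N N2N (ltn0Sn _) a aT; rewrite ler_norml => /andP[_]; lra.
have := JN N N1N (ltn0Sn _) 0; rewrite lexx ltW // => /(_ isT).
rewrite ler_norml => /andP[+ _].
rewrite -(vE 0) expi0 mul1r; move: vmax; rewrite ler_pdivlMr // mulrC; lra.
Qed.
End circular_means.

(** * From the Hardy space to the Bergman space *)

Section hardy_means.
Context {R : realType}.
Implicit Types (f : R[i] -> R[i]) (u : R[i] -> R) (z w : R[i]) (p K : R).
Local Notation leb := (@lebesgue_measure R).

Lemma le_poweR (x y : \bar R) (r : R) : 0 <= r ->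
  (0 <= x -> x <= y -> x `^ r <= y `^ r)%E.
Proof.
move=> r0 x0 xy; apply: gt0_ler_poweR => //; rewrite in_itv /= leey andbT //.
exact: le_trans xy.
Qed.

Lemma poweR_inv_le p K (x y : \bar R) : 0 < p -> 0 <= K -> (0 <= x)%E -> (0 <= y)%E ->
  (x `^ p^-1 <= K%:E * y `^ p^-1)%E <-> (x <= (K `^ p)%:E * y)%E.
Proof.
move=> p0 K0 x0 y0; have p0' : p != 0 by rewrite gt_eqF.
have KE : (0 <= K%:E)%E by rewrite lee_fin.
split => h.
  have := le_poweR (ltW p0) (poweR_ge0 _ _) h.
  rewrite poweRM ?poweR_ge0 // -!poweRrM mulVf // !poweRe1 //.
have pV : 0 <= p^-1 by rewrite invr_ge0 ltW.
have := le_poweR pV x0 h.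
rewrite poweRM ?lee_fin ?powR_ge0 // -[(K `^ p)%:E]poweR_EFin -poweRrM mulfV //.
by rewrite poweRe1.
Qed.

Lemma analytic_scale f z : analytic_on_disc f -> disc z ->
  analytic_on_disc (fun w => f (z * w)).
Proof.
move=> fa z1 w0 w01.
have zw : disc (z * w0).
  rewrite /disc /= cmodM; apply: le_lt_trans w01.
  by rewrite ler_piMl ?cmod_ge0 // ltW.
have [rho [a [rho0 fz]]] := fa _ zw.
exists rho, (fun k => a k * z ^+ k); split => // w ww.
have : cmod (z * w - z * w0) < rho.
  rewrite -mulrBr cmodM; apply: le_lt_trans ww.
  by rewrite ler_piMl ?cmod_ge0 // ltW.
have -> : (fun k => a k * z ^+ k * (w - w0) ^+ k) =
    (fun k => a k * (z * w - z * w0) ^+ k).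
  by apply/funext => k; rewrite -mulrBr exprMn mulrA.
exact: fz.
Qed.

Lemma circle_meanE p r f z :
  circle_mean p r (fun w => f (z * w)) =
  (((2 * pi)^-1)%R%:E * \int[leb]_(t in `[0%R, (2 * pi)%R])
     (cmod (f (expi t * (r%:C * z))) `^ p)%:E)%E.
Proof.
rewrite /circle_mean.
by under eq_integral do rewrite circle_pointE (mulrC z) -mulrA.
Qed.

Lemma circle_mean_ge0 p r f : (0 <= circle_mean p r f)%E.
Proof.
apply: mule_ge0; first by rewrite lee_fin invr_ge0 mulr_ge0 ?pi_ge0.
by apply: integral_ge0 => t _; rewrite lee_fin powR_ge0.
Qed.

Lemma circle_mean_scale_le p f z s : 0 < p -> analytic_on_disc f -> disc z ->
  0 <= s < 1 ->
  (circle_mean p s (fun w => f (z * w)%R) <= ((2 * pi)^-1)%R%:E *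
    \int[leb]_(t in `[0%R, (2 * pi)%R]) (cmod (f (expi t * z)) `^ p)%:E)%E.
Proof.
move=> p0 fa z1 /andP[s0 s1]; rewrite circle_meanE.
apply: lee_wpmul2l; first by rewrite lee_fin invr_ge0 mulr_ge0 ?pi_ge0.
apply: (@circle_integral_mono R (fun w => cmod (f w) `^ p)).
- by rewrite s0 ltW.
- move=> w wz; exact: (analytic_continuous_cmod p0 fa (le_lt_trans wz z1)).
- by move=> w wz; apply: submean_analytic p0 fa (lt_trans wz z1).
Qed.

Lemma circle_integral_fin p f z : 0 < p -> analytic_on_disc f -> disc z ->
  exists2 J : R, 0 <= J & (\int[leb]_(t in `[0%R, (2 * pi)%R])
    (cmod (f (expi t * z)) `^ p)%:E = J%:E)%E.
Proof.
move=> p0 fa z1.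
have [||J JE _] := @circle_riemann R (fun t => cmod (f (expi t * z)) `^ p).
- apply: (@continuous_expi R (fun w => cmod (f w) `^ p)) => t.
  have zt : disc (expi t * z) by rewrite /disc /= cmodM cmod_expi mul1r.
  exact: analytic_continuous_cmod.
- by move=> t; rewrite expiD2pi.
exists J; last exact: JE.
by rewrite -lee_fin -JE; apply: integral_ge0 => t _; rewrite lee_fin powR_ge0.
Qed.

(** The dilation [g] takes the value [f 0] at 0, so subtracting the value at the origin commutes
    with dilating. Its Hardy norm is bounded through the mean of [f] over the circle of [z], and the
    norm of [sub_at0 g] dominates the mean at radius [r]. *)
Lemma Hardy_mean_le p K f z (r : R) : 0 < p ->
  op_bound (Hardy p) (Hardy_norm p) (@sub_at0 R) K ->
  analytic_on_disc f -> disc z -> 0 <= r < 1 ->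
  (\int[leb]_(t in `[0%R, (2 * pi)%R])
     (cmod (f (expi t * (r%:C * z)) - f 0) `^ p)%:E <=
   (K `^ p)%:E * \int[leb]_(t in `[0%R, (2 * pi)%R])
     (cmod (f (expi t * z)) `^ p)%:E)%E.
Proof.
move=> p0 [K0 KH] fa z1 r01; pose g w := f (z * w).
have c0 : 0 < (2 * pi)^-1 :> R by rewrite invr_gt0 mulr_gt0 ?pi_gt0.
have [J J0 JE] := circle_integral_fin p0 fa z1.
have pV : 0 <= p^-1 by rewrite invr_ge0 ltW.
have gN : (Hardy_norm p g <= ((2 * pi)^-1 * J)%:E `^ p^-1)%E.
  apply: ge_ereal_sup => _ [s s01 <-].
  apply: (le_poweR pV (circle_mean_ge0 _ _ _)).
  by rewrite EFinM -JE; exact: circle_mean_scale_le.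
have gH : Hardy p g.
  split; first exact: analytic_scale.
  by apply: le_lt_trans gN _; apply: poweR_lty; exact: ltry.
have h := KH _ gH.
have gE : sub_at0 g = (fun w => (fun w => f w - f 0) (z * w)).
  by apply/funext => w; rewrite /sub_at0 /g mulr0.
have : (circle_mean p r (fun w => (fun w => f w - f 0)%R (z * w)%R) `^ p^-1 <=
    K%:E * ((2 * pi)^-1 * J)%:E `^ p^-1)%E.
  apply: (@le_trans _ _ (K%:E * Hardy_norm p g)%E); last first.
    by apply: lee_wpmul2l; [rewrite lee_fin|exact: gN].
  apply: le_trans h; rewrite gE.
  by apply: ereal_sup_ubound; exists r.
have cJ0 : (0 <= ((2 * pi)^-1 * J)%:E)%E by rewrite lee_fin mulr_ge0 // ltW.
move=> /(poweR_inv_le p0 K0 (circle_mean_ge0 _ _ _) cJ0).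
rewrite JE (circle_meanE p r (fun w => f w - f 0) z) EFinM muleCA.
by rewrite lee_pmul2l ?lte_fin.
Qed.
Lemma measurable_expi u z : (forall t, continuous_atC u (expi t * z)) ->
  measurable_fun (`[0%R, (2 * pi)%R]%classic : set (measurableTypeR R))
    (fun t => (u (expi t * z))%:E).
Proof.
move=> uc; apply/measurable_EFinP; apply: measurable_funTS.
by apply: continuous_measurable_fun; exact: continuous_expi.
Qed.

Lemma circle_mean_sub_le p K f z : 0 < p ->
  op_bound (Hardy p) (Hardy_norm p) (@sub_at0 R) K ->
  analytic_on_disc f -> disc z ->
  (\int[leb]_(t in `[0%R, (2 * pi)%R]) (cmod (f (expi t * z) - f 0) `^ p)%:E <=
   (K `^ p)%:E * \int[leb]_(t in `[0%R, (2 * pi)%R])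
     (cmod (f (expi t * z)) `^ p)%:E)%E.
Proof.
(* Radii in [[0, 1[] tending to 1; the bound at radius [r n] does not depend on [n]. *)
move=> p0 KH fa z1; pose r (n : nat) : R := 1 - n.+1%:R^-1.
have r01 n : 0 <= r n < 1.
  rewrite /r ltrBlDr ltrDl invr_gt0 ltr0n andbT subr_ge0.
  by rewrite invf_le1 ?ltr0n // ler1n.
have r_cvg : r n @[n --> \oo] --> (1 : R).
  rewrite -[X in _ --> X]subr0; apply: cvgB; first exact: cvg_cst.
  exact: cvg_harmonic.
pose F w := cmod (f w - f 0) `^ p.
have Fc w : disc w -> continuous_atC F w by move=> wd; exact: analytic_continuous.
have dexp t : disc (expi t * z) by rewrite /disc /= cmodM cmod_expi mul1r.
have drexp n t : disc (expi t * ((r n)%:C * z)).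
  have /andP[rn0 rn1] := r01 n.
  rewrite /disc /= !cmodM cmod_expi mul1r cmod_real ger0_norm //.
  by apply: le_lt_trans z1; rewrite ler_piMl ?cmod_ge0 // ltW.
have F_cvg w : disc w -> F ((r n)%:C * w) @[n --> \oo] --> F w.
  case: w => x y /Fc Fxy.
  have -> : (fun n => F ((r n)%:C * (x +i* y))) =
      (fun n => F ((r n * x) +i* (r n * y))).
    by apply/funext => n; simpc.
  have v1 : r n * x @[n --> \oo] --> x.
    by rewrite -[X in _ --> X]mul1r; apply: cvgM => //; exact: cvg_cst.
  have v2 : r n * y @[n --> \oo] --> y.
    by rewrite -[X in _ --> X]mul1r; apply: cvgM => //; exact: cvg_cst.
  have vg : (r n * x, r n * y) @[n --> \oo] --> (x, y) by exact: (cvg_pair v1 v2).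
  exact: (cvg_comp _ _ vg Fxy).
pose g (n : nat) t : \bar R := (F (expi t * ((r n)%:C * z)))%:E.
have mg n : measurable_fun (`[0%R, (2 * pi)%R]%classic : set (measurableTypeR R)) (g n).
  by apply: measurable_expi => t; apply: Fc.
have g0 n t : `[0%R, (2 * pi)%R]%classic t -> (0 <= g n t)%E.
  by move=> _; rewrite lee_fin powR_ge0.
have g_cvg t : g n t @[n --> \oo] --> (F (expi t * z))%:E.
  apply: cvg_EFin; first exact: nearW.
  have -> : fine \o g^~ t = (fun n => F ((r n)%:C * (expi t * z))).
    by apply/funext => n /=; rewrite mulrCA.
  exact: F_cvg.
have D : measurable (`[0%R, (2 * pi)%R]%classic : set (measurableTypeR R)) by [].
have := @fatou _ _ _ leb _ D g mg g0.
rewrite (eq_integral (fun t : measurableTypeR R => (F (expi t * z))%:E)); last first.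
  by move=> t _; have [-> _] := cvg_limn_einf_sup (g_cvg t).
move=> h; apply: le_trans h _.
(* The lower limit is the limit of the infima of tails, and each of these is at most the first
   integral of its tail. *)
rewrite limn_einf_lim; apply: lime_le; first exact: is_cvg_einfs.
apply: nearW => n.
apply: (@le_trans _ _ (\int[leb]_(t in `[0%R, (2 * pi)%R]) g n t)%E).
  by apply: ereal_inf_lbound; exists n => /=.
exact: Hardy_mean_le.
Qed.

End hardy_means.

(** * Borel measurability of functions continuous on an open set of the plane *)

Section plane_measurability.
Context {R : realType}.
Local Notation mR := (measurableTypeR R).

(** [U] is the countable union of the squares contained in it that have rational centre and
    half-width [n.+1%:R^-1]; squares are measurable rectangles. *)
Lemma open_measurable_plane (U : set (R * R)) : open U ->
  measurable (U : set (mR * mR)).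
Proof.
move=> oU.
pose I (p : rat) (d : R) : set mR := `]ratr p - d, ratr p + d[%classic.
pose Q p q d : set (mR * mR) := I p d `*` I q d.
pose V p q (n : nat) := let d := n.+1%:R^-1 in
  if `[< Q p q d `<=` U >] then Q p q d else set0.
have near (d t : R) : 0 < d -> exists p : rat, I p d t.
  move=> d0; have [|p] := @rat_in_itvoo R (t - d) (t + d); first by lra.
  rewrite in_itv /= => /andP[p1 p2]; exists p; rewrite /I /= in_itv /=.
  by apply/andP; split; lra.
have far (d t s : R) p : I p d t -> I p d s -> `|t - s| < d + d.
  rewrite /I /= !in_itv /= => /andP[t1 t2] /andP[s1 s2].
  by rewrite ltr_norml; apply/andP; split; lra.
have -> : U = \bigcup_p \bigcup_q \bigcup_n V p q n.
  apply/seteqP; split => [[x y] Uxy|z [p _ [q _ [n _]]]]; last first.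
    by rewrite /V /=; case: asboolP => // QU; exact: QU.
  have : nbhs (x, y) U by exact: open_nbhs_nbhs.
  case=> -[A B] /= [/nbhs_ballP[a /= a0 aA] /nbhs_ballP[b /= b0 bB]] ABU.
  (* The centre of the chosen square is not [(x, y)], but two points of a square of half-width [d]
     differ by less than [d + d] in each coordinate; hence the division by 2. *)
  pose e : R := Num.min a b / 2.
  have e0 : 0 < e by rewrite divr_gt0 // lt_min a0.
  pose n := Num.truncn e^-1.
  have : n.+1%:R^-1 < e.
    by rewrite -[ltRHS]invrK ltf_pV2 ?posrE ?invr_gt0 ?ltr0n // truncnS_gt.
  have : 0 < n.+1%:R^-1 :> R by rewrite invr_gt0 ltr0n.
  move dE : (n.+1%:R^-1) => d d0 de.
  have dab : d + d < Num.min a b by move: de; rewrite /e; lra.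
  have [p px] := near d x d0; have [q qy] := near d y d0.
  exists p => //; exists q => //; exists n => //; rewrite /V /= dE.
  case: asboolP => // -[] -[s t] /= [ps qt]; apply: ABU; split => /=.
    by apply: aA; have := lt_trans (far _ _ _ _ px ps) dab; rewrite lt_min => /andP[].
  by apply: bB; have := lt_trans (far _ _ _ _ qy qt) dab; rewrite lt_min => /andP[].
apply: bigcupT_measurable_rat => p; apply: bigcupT_measurable_rat => q.
apply: bigcupT_measurable => n; rewrite /V /=; case: ifP => // _.
by apply: measurableX; exact: measurable_itv.
Qed.

Lemma continuous_open_measurable_plane (U : set (R * R)) (h : R * R -> R) : open U ->
  (forall q, U q -> {for q, continuous h}) ->
  measurable_fun (U : set (mR * mR)) (h : mR * mR -> mR).
Proof.
move=> oU hc; apply: (measurability _ (RGenOInfty.measurableE R)).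
move=> _ [_ [a ->] <-]; apply: open_measurable_plane.
rewrite openE => q [Uq hq]; apply: filterI; first exact: open_nbhs_nbhs.
by apply: (hc q Uq); exact: open_nbhs_nbhs.
Qed.
End plane_measurability.

(** * Weighted integrals over the disc and the operator norm *)

Section bergman.
Context {R : realType}.
Implicit Types (f : R[i] -> R[i]) (mu F G : R[i] -> R) (p K : R).
Local Notation mR := (measurableTypeR R).
Local Notation leb := (@lebesgue_measure R).

Lemma open_plane_disc : open (@plane_disc R : set (R * R)).
Proof.
rewrite (_ : @plane_disc R = (fun q : R * R => cmod (q.1 +i* q.2) ^+ 2) @^-1` [set x | x < 1]).
  apply: open_comp; last exact: open_lt.
  by move=> q _; exact: continuous_cmod2.
apply/seteqP; split => q; rewrite /plane_disc /disc /to_complex /= => h.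
  by rewrite expr_lt1 ?cmod_ge0.
by rewrite -(@expr_lt1 _ 2) ?cmod_ge0.
Qed.

Lemma plane_disc_measurable : measurable (@plane_disc R).
Proof.
by apply: caratheodory_measurable_mu_ext; apply: open_measurable_plane open_plane_disc.
Qed.

Lemma to_complex_rot t (w : plane R) :
  to_complex (plane_rot (cos t) (sin t) w) = expi t * to_complex w.
Proof.
case: w => x y; rewrite /to_complex /plane_rot /expi /=; simpc.
by congr (_ +i* _); ring.
Qed.

Lemma cmod_rot c s (w : plane R) : c ^+ 2 + s ^+ 2 = 1 ->
  cmod (to_complex (plane_rot c s w)) = cmod (to_complex w).
Proof.
move=> cs; rewrite /to_complex /plane_rot /=; apply/eqP.
rewrite -(@eqrXn2 _ 2) ?cmod_ge0 // !cmodE.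
have -> : (c * w.1 - s * w.2) ^+ 2 + (s * w.1 + c * w.2) ^+ 2 =
  (c ^+ 2 + s ^+ 2) * (w.1 ^+ 2 + w.2 ^+ 2) by ring.
by rewrite cs mul1r.
Qed.

(** [F], [G] and [mu] are controlled only on the disc. Cutting all three off outside it gives
    functions measurable on the whole plane, and keeps the weight rotation invariant because the
    disc is. *)
Lemma disc_integral_le mu F G (k : R) : radial_weight mu -> 0 <= k ->
  (forall z, 0 <= F z) -> (forall z, 0 <= G z) ->
  (forall z, disc z -> continuous_atC F z) ->
  (forall z, disc z -> continuous_atC G z) ->
  (forall z, disc z ->
    (\int[leb]_(t in `[0%R, (2 * pi)%R]) (F (expi t * z))%:E <=
     k%:E * \int[leb]_(t in `[0%R, (2 * pi)%R]) (G (expi t * z))%:E)%E) ->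
  (disc_integral (fun z => (F z * mu z)%R) <=
   k%:E * disc_integral (fun z => (G z * mu z)%R))%E.
Proof.
move=> [mu0 mmu mur] k0 F0 G0 Fc Gc FG.
have pi0 : 0 < pi :> R := pi_gt0 R.
pose m : plane R -> R := (mu \o @to_complex R) \_ (@plane_disc R).
pose ext (H : R[i] -> R) : mR * mR -> R :=
  (fun w : mR * mR => H (w.1 +i* w.2)) \_ (@plane_disc R : set (mR * mR)).
have mext H : (forall z, disc z -> continuous_atC H z) -> measurable_fun setT (ext H).
  move=> Hc; apply: (measurable_restrictT _ (open_measurable_plane open_plane_disc)).1.
  apply: (continuous_open_measurable_plane open_plane_disc) => -[x y] xy.
  exact: (Hc _ xy).
have ext0 H : (forall z, 0 <= H z) -> forall w, 0 <= ext H w.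
  by move=> H0 w; rewrite /ext patchE; case: ifP.
have dE H : (\int[area R]_(w in @plane_disc R) (H (to_complex w) * mu (to_complex w))%:E =
    \int[area R]_w (ext H w * m w)%:E)%E.
  rewrite integral_mkcond; apply: eq_integral => w _.
  by rewrite /m /ext !patchE; case: ifP => //; rewrite mul0r.
rewrite /disc_integral muleCA; apply: lee_wpmul2l.
  by rewrite lee_fin invr_ge0 ltW.
rewrite !dE.
apply: (@integral_radial_le R `[0%R, (2 * pi)%R]%classic (2 * pi) k (ext F) (ext G) m).
- by [].
- by rewrite lebesgue_measure_itv /= lte_fin mulr_gt0 // oppr0 adde0.
- by rewrite mulr_gt0.
- by [].
- exact: mext.
- exact: ext0.
- exact: mext.
- exact: ext0.
- exact: (measurable_restrictT _ plane_disc_measurable).1 mmu.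
- by move=> w; rewrite /m patchE; case: ifP => // /set_mem wd; exact: mu0.
- move=> c s w cs; rewrite /m !patchE.
  have -> : (plane_rot c s w \in @plane_disc R) = (w \in @plane_disc R).
    by apply/idP/idP; rewrite !inE /plane_disc /disc /= cmod_rot.
  case: ifP => // /set_mem wd; apply: mur => //; last exact: cmod_rot.
  by rewrite /disc /= cmod_rot.
move=> w; rewrite /m patchE; case: ifP => [/set_mem wd _|]; last by rewrite eqxx.
have extE H : (\int[leb]_(t in `[0%R, (2 * pi)%R]) (ext H (plane_rot (cos t) (sin t) w))%:E =
    \int[leb]_(t in `[0%R, (2 * pi)%R]) (H (expi t * to_complex w))%:E)%E.
  apply: eq_integral => t _; rewrite /ext patchE ifT; last first.
    by rewrite inE /plane_disc /disc /= cmod_rot ?cos2Dsin2.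
  by rewrite -to_complex_rot.
rewrite !extE; exact: FG.
Qed.

Lemma disc_integral_ge0 H : (forall z, disc z -> 0 <= H z) ->
  (0 <= disc_integral (H : R[i] -> R))%E.
Proof.
move=> H0; apply: mule_ge0; first by rewrite lee_fin invr_ge0 pi_ge0.
by apply: integral_ge0 => w wd; rewrite lee_fin; exact: H0.
Qed.

Lemma Bergman_bound p K mu : 0 < p -> radial_weight mu ->
  op_bound (Hardy p) (Hardy_norm p) (@sub_at0 R) K ->
  op_bound (Bergman p mu) (Bergman_norm p mu) (@sub_at0 R) K.
Proof.
move=> p0 mur KH; have K0 := KH.1; split => // f [fa _].
have mu0 : forall z, disc z -> 0 <= mu z by case: mur.
have Int0 (H : R[i] -> R[i]) : (0 <= disc_integral (fun z => (cmod (H z) `^ p * mu z)%R))%E.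
  by apply: disc_integral_ge0 => z zd; rewrite mulr_ge0 ?powR_ge0 // mu0.
apply: (poweR_inv_le p0 K0 (Int0 _) (Int0 _)).2.
apply: (@disc_integral_le mu (fun z => cmod (f z - f 0) `^ p) (fun z => cmod (f z) `^ p)) => //.
- exact: powR_ge0.
- by move=> z; exact: powR_ge0.
- by move=> z; exact: powR_ge0.
- by move=> z zd; exact: analytic_continuous.
- by move=> z zd; exact: analytic_continuous_cmod.
- by move=> z zd; exact: circle_mean_sub_le.
Qed.

(** The infimum of all bounds is itself a bound: when [N f] is positive and finite, every bound is
    at least the quotient of [N (T f)] by [N f], hence so is the infimum; when [N f = 0], the bound
    [K] already forces [N (T f) = 0]. *)
Lemma exists_op_norm (S : set (R[i] -> R[i])) (N : (R[i] -> R[i]) -> \bar R)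
    (T : (R[i] -> R[i]) -> R[i] -> R[i]) K :
  (forall f, S f -> (0 <= N f < +oo)%E) -> (forall f, (0 <= N f)%E) ->
  op_bound S N T K -> exists2 L, is_op_norm S N T L & L <= K.
Proof.
move=> Nfin N0 KT; pose A := [set C | op_bound S N T C].
have A0 : A !=set0 by exists K.
have Alb : has_lbound A by exists 0 => C [].
have inf_le C : op_bound S N T C -> inf A <= C by move=> CT; apply: ge_inf.
exists (inf A); last exact: inf_le.
split => //; split => [|f Sf]; first by apply: lb_le_inf => // C [].
have /andP[Nf0 Nfoo] := Nfin f Sf.
have Nf : N f \is a fin_num by rewrite ge0_fin_numE.
have NT C : op_bound S N T C -> (N (T f) <= (C * fine (N f))%:E)%E.
  by move=> CT; rewrite EFinM fineK //; exact: CT.2.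
have NTf : N (T f) \is a fin_num.
  by rewrite ge0_fin_numE //; apply: le_lt_trans (NT _ KT) _; exact: ltry.
rewrite -(fineK Nf) -(fineK NTf) -EFinM lee_fin.
have [n0|n0] := eqVneq (fine (N f)) 0.
  by have := NT _ KT; rewrite -(fineK NTf) lee_fin n0 !mulr0.
have n1 : 0 < fine (N f) by rewrite lt_def n0 fine_ge0.
rewrite -ler_pdivrMr //; apply: lb_le_inf => // C CT.
by rewrite ler_pdivrMr // -lee_fin fineK //; exact: NT.
Qed.
End bergman.

Theorem theorem3p1 (R : realType) (p K : R) (mu : R[i] -> R) :
  0 < p ->
  is_op_norm (Hardy p) (Hardy_norm p) (@sub_at0 R) K ->
  radial_weight mu ->
  (disc_integral mu < +oo)%E ->
  exists2 L : R,
    is_op_norm (Bergman p mu) (Bergman_norm p mu) (@sub_at0 R) L & L <= K.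
Proof.
move=> p0 [KH _] mur _; apply: exists_op_norm (Bergman_bound p0 mur KH).
  by move=> f [_ fN]; rewrite fN poweR_ge0.
by move=> f; exact: poweR_ge0.
Qed.
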